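(* Let $h$ be a convex normal integrand on $\mathbb{R}^n\times\Omega$ such that $Eh$ is proper on $L^\infty$, and regard $Eh$ as a function on $L^\infty$ (so that $\operatorname{dom}Eh\subseteq L^\infty$). Assume that the set $$\mathcal D=\{x\in L^\infty(\operatorname{dom}h)\mid \exists r>0:\ \mathbb{B}(x(\omega),r)\cap\operatorname{aff}\operatorname{dom}h(\cdot,\omega)\subseteq\operatorname{dom}h(\cdot,\omega)\ \text{for }P\text{-a.e. }\omega\}$$ is nonempty and contained in $\operatorname{dom}Eh$. Then $Eh:L^\infty\to[-\infty,\infty]$ is closed, proper and convex, $\operatorname{aff}\operatorname{dom}Eh$ is closed in the norm topology of $L^\infty$, and $\operatorname{rint}_s\operatorname{dom}Eh=\mathcal D$. In particular, $Eh$ is norm-continuous at every point of $\mathcal D$ relative to $\operatorname{aff}\operatorname{dom}Eh$.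
   Context: $(\Omega,\mathcal F,P)$ is a probability space and $L^p:=L^p(\Omega,\mathcal F,P;\mathbb{R}^n)$. A normal integrand is a function $h:\mathbb{R}^n\times\Omega\to[-\infty,\infty]$ such that $\omega\mapsto\{(\xi,\alpha)\mid h(\xi,\omega)\le\alpha\}$ is a closed-valued $\mathcal F$-measurable set-valued mapping; it is convex if $h(\cdot,\omega)$ is convex for every $\omega$. For $x\in L^\infty$, $Eh(x)$ is the expectation of $\omega\mapsto h(x(\omega),\omega)$, where the expectation of a measurable function is defined as $+\infty$ unless its positive part is integrable. $\operatorname{dom}Eh=\{x\in L^\infty\mid Eh(x)<\infty\}$ and $\operatorname{dom}h(\cdot,\omega)=\{\xi\in\mathbb{R}^n\mid h(\xi,\omega)<\infty\}$. A function is proper if it never takes the value $-\infty$ and is not identically $+\infty$. For a set-valued mapping $S:\Omega\rightrightarrows\mathbb{R}^n$, $L^\infty(S)=\{x\in L^\infty\mid x(\omega)\in S(\omega)\ P\text{-a.s.}\}$; $L^\infty(\operatorname{dom}h)$ uses $S(\omega)=\operatorname{dom}h(\cdot,\omega)$. $\mathbb{B}(\xi,r)$ is the ball in $\mathbb{R}^n$ with center $\xi$ and radius $r$. $\operatorname{aff}$ is the affine hull. $\operatorname{rint}_sC$ (relative strong interior) of $C\subseteq L^\infty$ is the interior of $C$ relative to $\operatorname{aff}C$ in the norm topology of $L^\infty$. $Eh$ is closed if it coincides with its biconjugate with respect to the pairing $\langle z,v\rangle=E(z\cdot v)$ of $L^\infty$ with $L^1$. *)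

(* Defs.v *)
From HB Require Import structures.
From mathcomp Require Import all_boot all_order all_algebra ring_quotient.
From mathcomp Require Import all_classical all_reals all_analysis.
From mathcomp Require Import measurable_realfun ess_sup_inf.
From mathcomp Require Import ring lra.

Set Implicit Arguments.
Unset Strict Implicit.
Unset Printing Implicit Defensive.

Import Order.TTheory GRing.Theory Num.Theory.
Import numFieldNormedType.Exports.

Local Open Scope classical_set_scope.
Local Open Scope ring_scope.

Section euclidean.
Context {R : realType} {n : nat}.
Implicit Types x y : 'rV[R]_n.

Definition dotv x y : R := \sum_i x 0 i * y 0 i.

(* The library norm on 'rV[R]_n is the max norm. *)
Definition enorm x : R := Num.sqrt (dotv x x).

Definition eball x (r : R) : set 'rV[R]_n := [set y | enorm (y - x) <= r].

Lemma dotvv_ge0 x : 0 <= dotv x x.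
Proof. by apply: sumr_ge0 => i _; rewrite -expr2 sqr_ge0. Qed.

Lemma enorm_ge0 x : 0 <= enorm x. Proof. exact: sqrtr_ge0. Qed.

Lemma enorm_sqr x : enorm x ^+ 2 = dotv x x.
Proof. by rewrite sqr_sqrtr// dotvv_ge0. Qed.

Lemma enorm_eq0 x : enorm x = 0 -> x = 0.
Proof.
move=> x0; have : dotv x x = 0 by rewrite -enorm_sqr x0 expr0n.
move=> /eqP; rewrite psumr_eq0; last by move=> i _; rewrite -expr2 sqr_ge0.
move=> /allP x00; apply/rowP => i; rewrite mxE; apply/eqP.
by have := x00 i (mem_index_enum i); rewrite /= mulf_eq0 orbb.
Qed.

Lemma enorm0 : enorm 0 = 0.
Proof.
rewrite /enorm (_ : dotv 0 0 = 0) ?sqrtr0//.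
by rewrite /dotv big1// => i _; rewrite mxE mul0r.
Qed.

Lemma enormZ a x : enorm (a *: x) = `|a| * enorm x.
Proof.
rewrite /enorm (_ : dotv _ _ = a ^+ 2 * dotv x x).
  by rewrite sqrtrM ?sqr_ge0// sqrtr_sqr.
by rewrite /dotv mulr_sumr; apply: eq_bigr => i _; rewrite !mxE mulrACA expr2.
Qed.

Lemma dotv_le x y : dotv x y <= enorm x * enorm y.
Proof.
have [/eqP x0|x0] := boolP (enorm x == 0).
  rewrite (enorm_eq0 x0) /dotv big1 ?mulr_ge0 ?enorm_ge0// => i _.
  by rewrite mxE mul0r.
have [/eqP y0|y0] := boolP (enorm y == 0).
  rewrite (enorm_eq0 y0) /dotv big1 ?mulr_ge0 ?enorm_ge0// => i _.
  by rewrite mxE mulr0.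
have a0 : 0 < enorm x by rewrite lt_neqAle eq_sym x0 enorm_ge0.
have b0 : 0 < enorm y by rewrite lt_neqAle eq_sym y0 enorm_ge0.
have := dotvv_ge0 (enorm y *: x - enorm x *: y).
rewrite (_ : dotv _ _ = 2 * (enorm x * enorm y) *
                         (enorm x * enorm y - dotv x y)); last first.
  transitivity (enorm y ^+ 2 * dotv x x - 2 * (enorm x * enorm y) * dotv x y +
                enorm x ^+ 2 * dotv y y).
    rewrite /dotv !mulr_sumr -sumrB -big_split/=.
    by apply: eq_bigr => i _; rewrite !mxE; ring.
  by rewrite -!enorm_sqr; ring.
by rewrite pmulr_rge0 ?subr_ge0// !mulr_gt0.
Qed.

Lemma enormD x y : enorm (x + y) <= enorm x + enorm y.
Proof.
rewrite -ler_sqr ?nnegrE ?addr_ge0 ?enorm_ge0// enorm_sqr.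
rewrite (_ : dotv _ _ = dotv x x + 2 * dotv x y + dotv y y); last first.
  rewrite /dotv mulr_sumr -!big_split/=.
  by apply: eq_bigr => i _; rewrite !mxE; ring.
have := dotv_le x y; rewrite -!enorm_sqr; nra.
Qed.

End euclidean.

Lemma le_Lnorm d (T : measurableType d) (R : realType)
    (mu : {measure set T -> \bar R}) (p : \bar R) (f g : T -> R) :
  (1 <= p)%E -> measurable_fun setT f -> measurable_fun setT g ->
  (\forall w \ae mu, `|f w| <= `|g w|) ->
  ('N[mu]_p[EFin \o f] <= 'N[mu]_p[EFin \o g])%E.
Proof.
move=> p1 mf mg fg; rewrite unlock; case: p p1 => [r|_|//] /=.
- rewrite lee_fin => r1; have r0 : 0 <= r by rewrite (le_trans _ r1).
  have mpow (k : T -> R) : measurable_fun setT k ->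
      measurable_fun setT (fun w => `|k w| `^ r).
    move=> mk; apply: (@measurableT_comp _ _ _ _ _ _ (@powR R ^~ r)) => //.
    exact: measurableT_comp.
  apply: gt0_ler_poweR.
  + by rewrite invr_ge0.
  + by rewrite in_itv/= leey andbT integral_ge0// => w _; rewrite lee_fin powR_ge0.
  + by rewrite in_itv/= leey andbT integral_ge0// => w _; rewrite lee_fin powR_ge0.
  apply: ae_ge0_le_integral => //; [exact/measurable_EFinP/mpow..|].
  by apply: filterS fg => w fgw _; rewrite lee_fin ge0_ler_powR// nnegrE.
- case: ifPn => // _; apply: le_ess_sup.
  by apply: filterS fg => w; rewrite /= lee_fin.
Qed.

(* L^p(T, P; R^n): functions with measurable coordinates and finite L^p norm,
   modulo P-a.e. equality, as a normed space for the norm ||enorm x||_p. *)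
Section Lp_space.
Context {d : measure_display} {T : measurableType d} {R : realType}.
Variables (P : probability T R) (n : nat) (p : \bar R) (p1 : (1 <= p)%E).
Implicit Types x y : T -> 'rV[R]_n.

Definition mfunv x := forall j, measurable_fun setT (fun w => x w 0 j).

Definition Lpfun of (1 <= p)%E : {pred T -> 'rV[R]_n} :=
  mem [set x | mfunv x /\ finite_norm P p (enorm \o x)].

Lemma LpfunP x : x \in Lpfun p1 <-> mfunv x /\ finite_norm P p (enorm \o x).
Proof. by rewrite !inE. Qed.

Lemma mfunv_enorm x : mfunv x -> measurable_fun setT (enorm \o x).
Proof.
move=> mx; apply: (@measurableT_comp _ _ _ _ _ _ (@Num.sqrt R)).
  by apply: continuous_measurable_fun; exact: sqrt_continuous.
by apply: measurable_sum => i; exact: measurable_funM.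
Qed.

Lemma mfunv_lin (a : R) x y : mfunv x -> mfunv y -> mfunv (a *: x + y).
Proof.
move=> mx my j.
rewrite (_ : (fun _ => _) = (fun w => a * x w 0 j + y w 0 j)).
  by apply: measurable_funD => //; exact: measurable_funM.
by apply/funext => w; rewrite !mxE.
Qed.

Lemma LnormZ_enorm (a : R) x : x \in Lpfun p1 ->
  ('N[P]_p[EFin \o (enorm \o (a *: x))] =
    `|a|%:E * 'N[P]_p[EFin \o (enorm \o x)])%E.
Proof.
move=> /LpfunP[mx fx].
have xL : (enorm \o x) \in Lfun P p.
  by apply/andP; split; apply: mem_set => //; exact: mfunv_enorm.
have := LnormZ (Lfun_Sub p1 xL) `|a|; rewrite normr_id => <-.
by apply: eq_Lnorm => w /=; rewrite enormZ.
Qed.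

Lemma le_LnormD_enorm x y z : mfunv x -> mfunv y -> mfunv z ->
  (\forall w \ae P, z w = x w + y w) ->
  ('N[P]_p[EFin \o (enorm \o z)] <=
   'N[P]_p[EFin \o (enorm \o x)] + 'N[P]_p[EFin \o (enorm \o y)])%E.
Proof.
move=> mx my mz zxy; have mex := mfunv_enorm mx; have mey := mfunv_enorm my.
apply: le_trans (le_Lnorm p1 _ _ _) (eminkowski P mex mey p1).
- exact: mfunv_enorm.
- exact: measurable_funD.
apply: filterS zxy => w /= ->.
by rewrite !ger0_norm ?addr_ge0 ?enorm_ge0// enormD.
Qed.

Lemma Lpfun_submod_closed : submod_closed (Lpfun p1).
Proof.
split.
  apply/LpfunP; split=> [j|].
    rewrite (_ : (fun _ => _) = cst 0) //; apply/funext => w; by rewrite mxE.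
  rewrite (_ : enorm \o _ = cst 0); first exact: finite_norm_cst0.
  by apply/funext => w /=; rewrite enorm0.
move=> a x y xL yL; move: (xL) (yL) => /LpfunP[mx fx] /LpfunP[my fy].
have mZ : mfunv (a *: x) by rewrite -[_ *: _]addr0; apply: mfunv_lin.
apply/LpfunP; split; first exact: mfunv_lin.
rewrite /finite_norm (le_lt_trans (le_LnormD_enorm mZ my _ _))//.
- exact: mfunv_lin.
- exact: nearW.
by rewrite LnormZ_enorm// lte_add_pinfty// lte_mul_pinfty// lee_fin.
Qed.

HB.instance Definition _ :=
  GRing.isSubmodClosed.Build _ _ (Lpfun p1) Lpfun_submod_closed.

Record LpfunType := MkLpfun { Lpfun_val :> T -> 'rV[R]_n ; _ : Lpfun_val \in Lpfun p1 }.

HB.instance Definition _ := [isSub for Lpfun_val].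
HB.instance Definition _ := [Choice of LpfunType by <:].
HB.instance Definition _ := [SubChoice_isSubLmodule of LpfunType by <:].

Definition aenull : {pred LpfunType} :=
  mem [set x : LpfunType | \forall w \ae P, x w = 0].

Lemma aenull_submod_closed : submod_closed aenull.
Proof.
split; first by rewrite inE; exact: nearW.
move=> a x y; rewrite !inE => x0 y0; apply: filterS2 x0 y0 => w x0 y0.
by rewrite /= !fctE x0 y0 scaler0 addr0.
Qed.

HB.instance Definition _ :=
  GRing.isSubmodClosed.Build _ _ aenull aenull_submod_closed.

Local Open Scope quotient_scope.

Definition Lp : Type := Quotient.quot aenull.

HB.instance Definition _ := GRing.Zmodule.on Lp.
HB.instance Definition _ := EqQuotient.on Lp.

(* A chosen representative of the class x. *)
Definition Lp_fun (x : Lp) : T -> 'rV[R]_n := repr x.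
Coercion Lp_fun : Lp >-> Funclass.

Definition Lp_class (f : LpfunType) : Lp := \pi_Lp f.

Lemma mfunv_Lp (x : Lp) : mfunv x.
Proof. by case/LpfunP: (valP (repr x)). Qed.

Lemma finite_norm_Lp (x : Lp) : finite_norm P p (enorm \o x).
Proof. by case/LpfunP: (valP (repr x)). Qed.

Lemma Lp_classP (f g : LpfunType) :
  Lp_class f = Lp_class g <-> \forall w \ae P, f w = g w.
Proof.
split.
  move=> /eqP; rewrite /Lp_class -Quotient.idealrBE inE /=.
  by apply: filterS => w /eqP; rewrite /= !fctE subr_eq0 => /eqP.
move=> fg; apply/eqP; rewrite /Lp_class -Quotient.idealrBE inE /=.
by apply: filterS fg => w fgw; rewrite /= !fctE fgw subrr.
Qed.

Lemma Lp_fun_class (f : LpfunType) : \forall w \ae P, Lp_class f w = f w.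
Proof. by apply/(Lp_classP (repr (Lp_class f))); rewrite /Lp_class reprK. Qed.

Lemma Lp_eqP (x y : Lp) : x = y <-> \forall w \ae P, x w = y w.
Proof.
by rewrite -(Lp_classP (repr x) (repr y)) /Lp_class !reprK.
Qed.

Lemma Lp_fun0 : \forall w \ae P, (0 : Lp) w = 0.
Proof.
have := Lp_fun_class 0; rewrite (_ : Lp_class 0 = 0)//.
by rewrite /Lp_class raddf0.
Qed.

Lemma Lp_funD (x y : Lp) : \forall w \ae P, (x + y : Lp) w = x w + y w.
Proof.
have := Lp_fun_class (repr x + repr y).
by rewrite (_ : Lp_class _ = x + y)// /Lp_class raddfD /= !reprK.
Qed.

Definition Lp_scale (a : R) (x : Lp) : Lp := Lp_class (a *: repr x).

Lemma Lp_funZ_subproof a (x : Lp) : \forall w \ae P, Lp_scale a x w = a *: x w.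
Proof. exact: Lp_fun_class. Qed.

Lemma Lp_scaleA a b (x : Lp) : Lp_scale a (Lp_scale b x) = Lp_scale (a * b) x.
Proof.
apply/Lp_eqP; apply: filterS3 (Lp_funZ_subproof a (Lp_scale b x))
  (Lp_funZ_subproof b x) (Lp_funZ_subproof (a * b) x) => w -> -> ->.
by rewrite scalerA.
Qed.

Lemma Lp_scale1 : left_id 1 Lp_scale.
Proof.
move=> x; apply/Lp_eqP; apply: filterS (Lp_funZ_subproof 1 x) => w ->.
by rewrite scale1r.
Qed.

Lemma Lp_scaleDr : right_distributive Lp_scale +%R.
Proof.
move=> a x y; apply/Lp_eqP; near=> w.
rewrite (near (Lp_funZ_subproof a (x + y)) w)// (near (Lp_funD x y) w)//.
rewrite (near (Lp_funD (Lp_scale a x) (Lp_scale a y)) w)//.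
rewrite (near (Lp_funZ_subproof a x) w)// (near (Lp_funZ_subproof a y) w)//.
by rewrite scalerDr.
Unshelve. all: by end_near. Qed.

Lemma Lp_scaleDl (x : Lp) : {morph Lp_scale^~ x : a b / a + b}.
Proof.
move=> a b; apply/Lp_eqP; near=> w.
rewrite (near (Lp_funZ_subproof (a + b) x) w)//.
rewrite (near (Lp_funD (Lp_scale a x) (Lp_scale b x)) w)//.
rewrite (near (Lp_funZ_subproof a x) w)// (near (Lp_funZ_subproof b x) w)//.
by rewrite scalerDl.
Unshelve. all: by end_near. Qed.

HB.instance Definition _ := GRing.Zmodule_isLmodule.Build R Lp
  Lp_scaleA Lp_scale1 Lp_scaleDr Lp_scaleDl.

Lemma Lp_funZ a (x : Lp) : \forall w \ae P, (a *: x : Lp) w = a *: x w.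
Proof. exact: Lp_funZ_subproof. Qed.

Definition Lp_norm (x : Lp) : R := fine 'N[P]_p[EFin \o (enorm \o x)].

Lemma Lp_normE (x : Lp) : (Lp_norm x)%:E = 'N[P]_p[EFin \o (enorm \o x)]%E.
Proof. by rewrite fineK// ge0_fin_numE ?Lnorm_ge0//; exact: finite_norm_Lp. Qed.

Lemma ler_Lp_normD (x y : Lp) : Lp_norm (x + y) <= Lp_norm x + Lp_norm y.
Proof.
rewrite -lee_fin EFinD !Lp_normE le_LnormD_enorm//; try exact: mfunv_Lp.
exact: Lp_funD.
Qed.

Lemma Lp_normZ a (x : Lp) : Lp_norm (a *: x) = `|a| * Lp_norm x.
Proof.
apply/EFin_inj; rewrite EFinM !Lp_normE -LnormZ_enorm; last exact: valP (repr x).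
have mZ : mfunv (a *: (x : T -> 'rV[R]_n)).
  rewrite -[_ *: _]addr0; apply: mfunv_lin; first exact: mfunv_Lp.
  by case/LpfunP: (valP (0 : LpfunType)).
by apply/eqP; rewrite eq_le; apply/andP; split; apply: le_Lnorm => //;
  do ?[exact/mfunv_enorm/mfunv_Lp|exact: mfunv_enorm];
  apply: filterS (Lp_funZ a x) => w /= ->.
Qed.

Lemma Lp_norm0_eq0 (x : Lp) : Lp_norm x = 0 -> x = 0.
Proof.
move=> x0; apply/Lp_eqP.
have p0 : (0 < p)%E by exact: lt_le_trans p1.
have mx : measurable_fun setT (EFin \o (enorm \o x)).
  exact/measurable_EFinP/mfunv_enorm/mfunv_Lp.
have : ('N[P]_p[EFin \o (enorm \o x)] = 0)%E by rewrite -Lp_normE x0.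
move=> /(Lnorm_eq0_eq0 mx p0) x00.
apply: filterS2 x00 Lp_fun0 => w /(_ I) [/enorm_eq0 xw] ->.
exact: xw.
Qed.

HB.instance Definition _ :=
  Lmodule_isNormed.Build R Lp ler_Lp_normD Lp_normZ Lp_norm0_eq0.

End Lp_space.

Notation Linf P n := (Lp P n (leey 1%E)).
Notation Lone P n := (Lp P n (lexx 1%E)).

Section extended_real_valued_functions.
Context {R : realType} {V : lmodType R}.
Implicit Types (f : V -> \bar R) (C : set V).

Definition epi f : set (V * R^o) := [set z | (f z.1 <= z.2%:E)%E].

Definition edom f : set V := [set x | (f x < +oo)%E].

Definition proper_fun f := (forall x, f x != -oo%E) /\ (exists x, f x != +oo%E).

Definition convex_fun f := convex_set (epi f).

Definition affine_set C :=
  forall x y (t : R), C x -> C y -> C ((1 - t) *: x + t *: y).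

Definition affine_hull C : set V :=
  \bigcap_(A in [set A | affine_set A /\ C `<=` A]) A.

End extended_real_valued_functions.

(* Interior of C in the subspace topology of its affine hull. Points outside
   the hull are isolated in [subspace], but none of them belongs to C. *)
Definition rint {R : realType} {V : normedModType R} (C : set V) : set V :=
  @interior (subspace (affine_hull C)) C.

Section integral_functionals.
Context {d : measure_display} {T : measurableType d} {R : realType}.
Variables (P : probability T R) (n : nat).
Implicit Types h : 'rV[R]_n -> T -> \bar R.

Definition measurable_mapping (X : topologicalType) (S : T -> set X) :=
  forall U : set X, open U -> measurable [set w | S w `&` U !=set0].

Definition normal_integrand h :=
  (forall w, closed (epi (h ^~ w))) /\
  measurable_mapping (fun w => epi (h ^~ w)).

Definition convex_normal_integrand h :=
  normal_integrand h /\ forall w, convex_fun (h ^~ w).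

Definition expect (f : T -> \bar R) : \bar R :=
  if `[< P.-integrable setT (f^\+)%E >] then (\int[P]_w f w)%E else +oo%E.

Definition Eint h (x : Linf P n) : \bar R := expect (fun w => h (x w) w).

Definition Linf_sel (S : T -> set 'rV[R]_n) : set (Linf P n) :=
  [set x | \forall w \ae P, S w (x w)].

Definition Dset h : set (Linf P n) :=
  [set x | Linf_sel (fun w => edom (h ^~ w)) x /\
    exists2 r : R, 0 < r & \forall w \ae P,
      eball (x w) r `&` affine_hull (edom (h ^~ w)) `<=` edom (h ^~ w)].

Definition pairing (z : Linf P n) (v : Lone P n) : R :=
  (\int[P]_w dotv (z w) (v w))%R.

Definition conjugate (f : Linf P n -> \bar R) (v : Lone P n) : \bar R :=
  ereal_sup [set ((pairing z v)%:E - f z)%E | z in setT].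

Definition biconjugate (f : Linf P n -> \bar R) (z : Linf P n) : \bar R :=
  ereal_sup [set ((pairing z v)%:E - conjugate f v)%E | v in setT].

Definition closed_fun (f : Linf P n -> \bar R) := biconjugate f = f.

End integral_functionals.

Arguments expect {d T R} P f.
Arguments Eint {d T R} P {n} h x.
Arguments Linf_sel {d T R} P {n} S _.
Arguments Dset {d T R} P {n} h _.

(* Main.v *)
Require Import Defs.
From mathcomp Require Import all_boot all_order all_algebra.
From mathcomp Require Import all_classical all_reals all_analysis.
From mathcomp Require Import measurable_realfun ess_sup_inf ring lra.
Set Implicit Arguments.
Unset Strict Implicit.
Unset Printing Implicit Defensive.
Import Order.TTheory GRing.Theory Num.Theory numFieldNormedType.Exports.
Local Open Scope classical_set_scope.
Local Open Scope ring_scope.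

(* Fix x0 in D and let A(w) be the affine hull of dom h(.,w). Points of
   L^oo(A) close to x0 are again in D, so aff dom Eh = L^oo(A), which is closed,
   and the description of rint follows by stretching segments from x0.

   Continuity: by convexity it suffices to bound Eh above near x in D. If Eh
   were unbounded along y_k -> x, then sup_k h(y_k(w), w) would still be finite
   for a.e. w because h(., w) is locally bounded on A(w), and choosing
   measurably an index k(w) almost attaining this supremum would give a point
   of D outside dom Eh.

   Closedness: minimizing |eta - q|^2 + k a^2 + 2 m a over the epigraph of
   h(., w) has a measurable solution, since eta is read off the gradient of the
   minimal value in q. With k = 1 this projects (x0, h(x0) - 1) on the epigraph
   and gives a measurable 1-subgradient v0 at x0, integrable since
   x0 + (r/2) v0/|v0| is in D. With k = 0 it gives the Moreau envelopes of
   h - v0, whose gradients yield L^1 affine minorants of Eh; by Fatou's lemma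
   their values at z recover Eh(z). *)

(** * Inner product and Euclidean norm estimates *)

Section dot_product.
Context {R : realType} {n : nat}.
Implicit Types x y z : 'rV[R]_n.

Lemma dotvC x y : dotv x y = dotv y x.
Proof. by apply: eq_bigr => i _; rewrite mulrC. Qed.

Lemma dotvDl x y z : dotv (x + y) z = dotv x z + dotv y z.
Proof. by rewrite -big_split; apply: eq_bigr => i _; rewrite mxE mulrDl. Qed.

Lemma dotvZl a x y : dotv (a *: x) y = a * dotv x y.
Proof. by rewrite mulr_sumr; apply: eq_bigr => i _; rewrite mxE mulrA. Qed.

Lemma dotvNl x y : dotv (- x) y = - dotv x y.
Proof. by rewrite -scaleN1r dotvZl mulN1r. Qed.

Lemma dotvBl x y z : dotv (x - y) z = dotv x z - dotv y z.
Proof. by rewrite dotvDl dotvNl. Qed.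

Lemma dotvDr x y z : dotv x (y + z) = dotv x y + dotv x z.
Proof. by rewrite !(dotvC x) dotvDl. Qed.

Lemma dotvZr a x y : dotv x (a *: y) = a * dotv x y.
Proof. by rewrite !(dotvC x) dotvZl. Qed.

Lemma dotvNr x y : dotv x (- y) = - dotv x y.
Proof. by rewrite !(dotvC x) dotvNl. Qed.

Lemma dotvBr x y z : dotv x (y - z) = dotv x y - dotv x z.
Proof. by rewrite dotvDr dotvNr. Qed.

Lemma dotv_delta x i : dotv x (delta_mx 0 i) = x 0 i.
Proof.
rewrite /dotv (bigD1 i)//= big1 ?addr0 => [|j ji]; rewrite !mxE ?eqxx ?mulr1//.
by rewrite (negbTE ji) mulr0.
Qed.

Lemma enormN x : enorm (- x) = enorm x.
Proof. by rewrite -scaleN1r enormZ normrN1 mul1r. Qed.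

Lemma enormB x y : enorm (x - y) = enorm (y - x).
Proof. by rewrite -enormN opprB. Qed.

Lemma dotv_norm_le x y : `|dotv x y| <= enorm x * enorm y.
Proof.
rewrite ler_norml dotv_le andbT lerNl -dotvNl (le_trans (dotv_le _ _))//.
by rewrite enormN.
Qed.

Lemma coord_le_enorm x i : `|x 0 i| <= enorm x.
Proof.
rewrite -[X in `|X|]dotv_delta (le_trans (dotv_norm_le _ _))//.
rewrite [X in _ * X](_ : _ = 1) ?mulr1//.
by rewrite /enorm dotv_delta mxE !eqxx sqrtr1.
Qed.

(** Continuity of a linear map, with one constant for all coordinates. Applied to [cokermx] it shows
    that subspaces are closed; applied to [pinvmx] it bounds coefficients in a spanning family. *)
Lemma mulmx_coord_bound m (Q : 'M[R]_(n, m)) :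
  exists2 K : R, 0 <= K & forall u j, `|(u *m Q) 0 j| <= K * enorm u.
Proof.
exists (\sum_j \sum_i `|Q i j|) => [|u j].
  by apply: sumr_ge0 => j _; exact: sumr_ge0.
rewrite mxE (le_trans (ler_norm_sum _ _ _))//.
rewrite (bigD1 j)//= mulrDl ler_wpDr//.
  by rewrite mulr_ge0 ?enorm_ge0// sumr_ge0// => ? _; exact: sumr_ge0.
rewrite mulr_suml ler_sum// => i _.
by rewrite normrM mulrC ler_wpM2l// coord_le_enorm.
Qed.

End dot_product.

(** * Affine sets, their direction spaces and their closedness in finite dimension *)

Section affine_sets.
Context {R : realType} {V : lmodType R}.
Implicit Types (x y z : V) (C A : set V).

Lemma affine_hull_affine C : affine_set (affine_hull C).
Proof.
by move=> x y t Cx Cy A [aA CA]; apply: (aA); [apply: Cx|apply: Cy].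
Qed.

Lemma sub_affine_hull C : C `<=` affine_hull C.
Proof. by move=> x Cx A [_]; apply. Qed.

Lemma affine_hull_min C A : affine_set A -> C `<=` A -> affine_hull C `<=` A.
Proof. by move=> aA CA x; apply. Qed.

(** The point is the midpoint of [(1 - 2t) x + 2t y] and [(1 + 2t) x - 2t z], both of which lie on
    lines through two points of [A]. *)
Lemma affine_setD A x y z (t : R) :
  affine_set A -> A x -> A y -> A z -> A (x + t *: (y - z)).
Proof.
move=> aA Ax Ay Az.
have A1 := aA _ _ (2 * t) Ax Ay; have A2 := aA _ _ (- 2 * t) Ax Az.
have := aA _ _ 2^-1 A1 A2; congr (A _).
rewrite [X in X *: _ + _](_ : 1 - 2^-1 = 2^-1); last by field.
rewrite !scalerDr !scalerA.
rewrite (_ : 2^-1 * (2 * t) = t); last by field.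
rewrite (_ : 2^-1 * (-2 * t) = - t); last by field.
rewrite addrACA -scalerDl (_ : _ + _ = 1); last by field.
by rewrite scale1r scalerN scaleNr.
Qed.

(** This is what makes [A - x] a linear subspace, so that matrix rank arguments apply to it. *)
Lemma affine_set_direction A x (t : R) u v : affine_set A -> A x ->
  A (x + u) -> A (x + v) -> A (x + (t *: u + v)).
Proof.
move=> aA Ax Au Av; have := affine_setD t aA Av Au Ax.
by rewrite [x + u - x]addrAC subrr add0r -addrA [v + _]addrC.
Qed.

End affine_sets.

Section linear_sets.
Context {R : realType} {n : nat}.
Implicit Types (L A : set 'rV[R]_n) (x y u : 'rV[R]_n).

Lemma linear_set_mulmx L m (B : 'M[R]_(m, n)) (c : 'rV[R]_m) :
  L 0 -> (forall (t : R) u v, L u -> L v -> L (t *: u + v)) ->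
  (forall i, L (row i B)) -> L (c *m B).
Proof.
move=> L0 LD LB; rewrite mulmx_sum_row.
apply: (big_ind L) => // [u v Lu Lv|i _]; first by rewrite -[u]scale1r; exact: LD.
by rewrite -[_ *: _]addr0; exact: LD.
Qed.

(** Among the matrices with rows in [L], one of maximal rank must span [L]: adjoining a vector of
    [L] outside its row space would raise the rank. *)
Lemma linear_set_span L :
  L 0 -> (forall (t : R) u v, L u -> L v -> L (t *: u + v)) ->
  exists2 B : 'M[R]_n, forall i, L (row i B) & forall u, L u -> (u <= B)%MS.
Proof.
move=> L0 LD.
pose Q k := `[< exists2 B : 'M[R]_n, forall i, L (row i B) & \rank B = k >].
have Qbd k : Q k -> (k <= n)%N by move=> /asboolP[B _ <-]; exact: rank_leq_col.
have Q0 : exists k, Q k.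
  by exists 0%N; apply/asboolP; exists 0; rewrite ?mxrank0// => i; rewrite row0.
case: (ex_maxnP Q0 Qbd) => k /asboolP[B LB rB] kmax; exists B => // u Lu.
apply: contrapT => /negP uB.
have : Q (\rank (B + u)%MS).
  apply/asboolP; exists (B + u)%MS => // i.
  have /submxP[c ->] : (row i (B + u)%MS <= col_mx B u)%MS.
    by rewrite -addsmxE row_sub.
  apply: linear_set_mulmx => // j; rewrite -(splitK j).
  case: (fintype.split j) => j' /=; first by rewrite rowKu.
  by rewrite rowKd row_id.
move=> /kmax; rewrite leqNgt -rB => /negP; apply.
rewrite ltn_neqAle mxrankS ?addsmxSl// andbT.
by rewrite (mxrank_leqif_sup (addsmxSl B u)).2 addsmx_sub submx_refl.
Qed.

(** The direction space is the row space of some [B], hence the zero set of [u *m cokermx B], and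
    this map is continuous. *)
Lemma affine_set_closed A x : affine_set A ->
  (forall e : R, 0 < e -> exists2 y, A y & enorm (x - y) < e) -> A x.
Proof.
move=> aA Ax; have [x0 Ax0 _] := Ax 1 ltr01.
pose L := [set u | A (x0 + u)].
have L0 : L 0 by rewrite /L/= addr0.
have LD (t : R) u v : L u -> L v -> L (t *: u + v) by exact: affine_set_direction.
have [B LB LsubB] := linear_set_span L0 LD.
have LP u : (u <= B)%MS -> L u by move=> /submxP[c ->]; exact: linear_set_mulmx.
suff : L (x - x0) by rewrite /L/= addrC subrK.
apply: LP; rewrite submxE; apply/eqP/rowP => j; rewrite [RHS]mxE.
have [K K0 KP] := mulmx_coord_bound (cokermx B).
apply/eqP; rewrite -normr_le0; apply/ler_addgt0Pr => e e0; rewrite add0r.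
(* [K + 1] in place of [K] keeps the divisor positive. *)
have [y Ay xy] := Ax (e / (K + 1)) (divr_gt0 e0 (ltr_wpDl K0 ltr01)).
have /LsubB : L (y - x0) by rewrite /L/= addrC subrK.
rewrite submxE => /eqP y0.
rewrite (_ : x - x0 = (x - y) + (y - x0)); last by rewrite addrA subrK.
rewrite mulmxDl y0 addr0 (le_trans (KP _ _))//.
rewrite (le_trans (ler_wpM2l K0 (ltW xy)))// mulrCA ger_pMr//.
by rewrite ler_pdivrMr ?mul1r ?lerDl// ltr_wpDl.
Qed.

End linear_sets.

(** * Convex functions with extended values: local upper bounds *)

Section convex_functions.
Context {R : realType}.

(** Real upper bounds [a] and [b] replace the values of [f], so that no sum of opposite infinities
    can occur. *)
Lemma convex_funP (V : lmodType R) (f : V -> \bar R) : convex_fun f <->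
  (forall x y (a b t : R), 0 <= t <= 1 -> (f x <= a%:E)%E -> (f y <= b%:E)%E ->
     (f (t *: x + (1 - t) *: y)%R <= (t * a + (1 - t) * b)%:E)%E).
Proof.
split=> [cf x y a b t /andP[t0 t1] fx fy|cf [x a] [y b] t].
  have := cf (x, a) (y, b) (Itv01 t0 t1).
  by rewrite !inE; exact.
rewrite !inE /epi /= => fx fy; apply: cf => //.
by apply/andP; split; [exact: ge0|exact: le1].
Qed.

Lemma lty_le_fine (e : \bar R) : (e < +oo -> e <= `|fine e|%:E)%E.
Proof. by case: e => [r| |]//= _; rewrite ?leNye// lee_fin ler_norm. Qed.

(** By induction: [x + (v i + s)] is the midpoint of [x + 2 v i] and [x + 2 s]. Every summand is
    doubled at most once per element of the list, whence the factor [2 ^+ size l]. *)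
Lemma convex_set_sum (V : lmodType R) (K : set V) (I : Type) (l : seq I)
    (v : I -> V) x :
  (forall y z (t : R), 0 <= t <= 1 -> K y -> K z -> K (t *: y + (1 - t) *: z)) ->
  K x -> (forall i (t : R), `|t| <= 2 ^+ size l -> K (x + t *: v i)) ->
  K (x + \sum_(i <- l) v i).
Proof.
move=> cK Kx; elim: l v => [|i l IH] v Kv; first by rewrite big_nil addr0.
have half : 0 <= (2^-1 : R) <= 1 by apply/andP; split; lra.
rewrite big_cons.
have K1 : K (x + 2 *: v i).
  apply: Kv; rewrite ger0_norm// exprS ler_peMr// exprn_ege1//.
  by rewrite (@ler_nat R 1 2).
have K2 : K (x + \sum_(i <- l) 2 *: v i).
  apply: IH => j t tl; rewrite scalerA; apply: Kv.
  by rewrite normrM exprS mulrC [`|2|]ger0_norm// ler_wpM2l.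
have := cK _ _ _ half K1 K2; congr (K _).
rewrite [X in _ + X *: _](_ : 1 - 2^-1 = 2^-1); last by field.
rewrite -scaler_sumr -scalerDr addrACA -scalerDr (scalerDr 2^-1) scalerA.
rewrite mulVf// scale1r scalerDr -scalerDl (_ : 2^-1 + 2^-1 = 1); last by field.
by rewrite scale1r.
Qed.

(** The directions of [A] are spanned by finitely many rows. A number [M] that bounds [f] at [x] and
    at [x] plus or minus a small multiple of each row defines a convex sublevel set [K], and every
    point of [A] near [x] is [x] plus a sum of small multiples of the rows, hence in [K] by
    [convex_set_sum]. *)
Lemma convex_fun_locally_bounded n (f : 'rV[R]_n -> \bar R) A x (r : R) :
  convex_fun f -> affine_set A -> A x -> 0 < r ->
  (forall y, A y -> enorm (y - x) <= r -> (f y < +oo)%E) ->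
  exists M : R, exists2 delta, 0 < delta &
    forall y, A y -> enorm (y - x) <= delta -> (f y <= M%:E)%E.
Proof.
move=> /convex_funP cf aA Ax r0 fr.
pose L := [set u | A (x + u)].
have L0 : L 0 by rewrite /L/= addr0.
have LD (t : R) u v : L u -> L v -> L (t *: u + v) by exact: affine_set_direction.
have [B LB LsubB] := linear_set_span L0 LD.
have LZ (t : R) i : L (t *: row i B) by rewrite -[_ *: _]addr0; exact: LD.
(* Dividing [r] by [S] makes every scaled row at most [r] long; the summand 1 keeps [S] positive. *)
pose S := 1 + \sum_i enorm (row i B).
have S1 : 1 <= S by rewrite lerDl sumr_ge0// => i _; exact: enorm_ge0.
have S0 : 0 < S by exact: lt_le_trans S1.
pose s := r / S; have s0 : 0 < s by exact: divr_gt0.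
have rowle i : s * enorm (row i B) <= r.
  rewrite /s mulrAC ler_pdivrMr// ler_pM2l// /S (bigD1 i)//= addrCA lerDl.
  by rewrite addr_ge0// sumr_ge0// => j _; exact: enorm_ge0.
have frow (t : R) i : `|t| = s -> (f (x + t *: row i B)%R < +oo)%E.
  move=> ts; apply: fr; first exact: LZ.
  by rewrite addrC addKr enormZ ts.
pose G i := `|fine (f (x + s *: row i B))| + `|fine (f (x + (- s) *: row i B))|.
pose M := `|fine (f x)| + \sum_i G i.
have G0 i : 0 <= G i by exact: addr_ge0.
pose K := [set y | (f y <= M%:E)%E].
have cK y z (t : R) : 0 <= t <= 1 -> K y -> K z -> K (t *: y + (1 - t) *: z).
  move=> t01 Ky Kz; have := cf _ _ _ _ _ t01 Ky Kz.
  by rewrite (_ : t * M + (1 - t) * M = M)//; ring.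
have Kx : K x.
  rewrite /K/= (le_trans (lty_le_fine _))//.
    by apply: fr => //; rewrite subrr enorm0 ltW.
  by rewrite lee_fin lerDl sumr_ge0.
have GM i : G i <= M.
  by rewrite /M (bigD1 i)//= addrCA lerDl addr_ge0// sumr_ge0.
have Krow i : K (x + s *: row i B).
  apply: (le_trans (lty_le_fine _)); first by apply: frow; rewrite gtr0_norm.
  by rewrite lee_fin (le_trans _ (GM i))// /G lerDl.
have KNrow i : K (x + (- s) *: row i B).
  apply: (le_trans (lty_le_fine _)).
    by apply: frow; rewrite normrN gtr0_norm.
  by rewrite lee_fin (le_trans _ (GM i))// /G lerDr.
have Kseg (t : R) i : `|t| <= s -> K (x + t *: row i B).
  rewrite ler_norml => /andP[st ts].
  (* The weight that writes [x + t *: row i B] as a convex combination of the two endpoints with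
     coefficients [s] and [- s]. *)
  pose a := (s + t) / (2 * s).
  have a01 : 0 <= a <= 1.
    have s2 : 0 < 2 * s by rewrite mulr_gt0.
    by rewrite /a divr_ge0 ?(ltW s2)//= ?ler_pdivrMr//; lra.
  have := cK _ _ _ a01 (Krow i) (KNrow i); congr (K _).
  rewrite !scalerDr addrACA -scalerDl [a + _]addrC subrK scale1r.
  rewrite !scalerA -scalerDl; congr (_ + _ *: _).
  by rewrite /a; field; rewrite gt_eqF.
have [k k0 kP] := mulmx_coord_bound (pinvmx B).
pose N : R := 2 ^+ size (index_enum 'I_n).
have N0 : 0 < N by exact: exprn_gt0.
(* The coefficients of [y - x] in the rows are then at most [s / N], and they remain at most [s]
   after the stretching by [N] that [convex_set_sum] demands. *)
exists M, (s / N / (k + 1)) => [|y Ay yx].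
  by rewrite !divr_gt0// ltr_wpDl.
have Lyx : L (y - x) by rewrite /L/= addrC subrK.
have := mulmxKpV (LsubB _ Lyx); rewrite mulmx_sum_row => yE.
have -> : y = x + (y - x) by rewrite addrC subrK.
rewrite -[in f _]yE.
apply: (@convex_set_sum _ K) => // i t tN.
rewrite scalerA; apply: Kseg; rewrite normrM.
apply: (le_trans (ler_pM _ _ tN (kP _ _))) => //.
apply: (@le_trans _ _ (N * ((k + 1) * (s / N / (k + 1))))).
  by rewrite ler_pM2l// ler_pM// ?enorm_ge0// lerDl.
rewrite le_eqVlt (_ : _ == _)//; apply/eqP; field.
by rewrite !gt_eqF// ltr_wpDl.
Qed.

End convex_functions.

(** * Measurability of hitting sets and of compositions with a normal integrand *)

Section measurable_mappings.
Context {d : measure_display} {T : measurableType d} {R : realType} {n : nat}.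
Local Notation VR := ('rV[R]_n * R^o)%type.
Implicit Types (C : T -> set VR) (q : T -> 'rV[R]_n) (m : T -> R).

Lemma rational_near (x : VR) (e : R) : 0 < e ->
  exists r : 'rV[rat]_n * rat, ball (map_mx ratr r.1 : 'rV[R]_n, ratr r.2 : R^o) e x.
Proof.
move=> e0; have rat_near (y : R) : exists s : rat, ball (ratr s : R) e y.
  have /rat_in_itvoo[s] : y - e < y + e by lra.
  rewrite in_itv/= => /andP[ys sy]; exists s.
  by rewrite /ball/= ltr_norml; apply/andP; split; lra.
have /choice[s sP] := fun j => rat_near (x.1 0 j).
have [t tP] := rat_near x.2.
exists (\row_j s j, t); split => //; split => // i j.
by rewrite !mxE ord1; exact: sP.
Qed.

Lemma measurable_ball_preimage q m (c : VR) (e : R) : mfunv q ->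
  measurable_fun setT m -> measurable [set w | ball c e (q w, m w : R^o)].
Proof.
move=> mq mm; have [e0|e0] := leP e 0.
  rewrite (_ : [set _ | _] = set0)//; apply/seteqP; split=> // w [_ /=].
  by rewrite /ball/= => /(le_lt_trans (normr_ge0 _)); rewrite ltNge e0.
rewrite (_ : [set _ | _] =
   (\bigcap_(j in [set: 'I_n]) ((fun w => q w 0 j) @^-1` ball (c.1 0 j) e)) `&`
   (m @^-1` ball (c.2 : R) e)).
  apply: measurableI.
    apply: fin_bigcap_measurable => // j _.
    by rewrite -[X in measurable X]setTI; apply: mq => //; exact: measurable_ball.
  by rewrite -[X in measurable X]setTI; apply: mm => //; exact: measurable_ball.
apply/seteqP; split=> w /=; first by move=> [[_ h1] h2]; split => // j _; exact: h1.
by move=> [h1 h2]; split => //; split => // i j; rewrite ord1; exact: h1.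
Qed.

(** The open set [U] is a countable union of products of a ball [B i] with rational centre and
    radius [1/(k+1)] and the open set [W i] of points [y] around which the whole strip over [B i]
    stays in [U]. On one product the condition splits into one on [(q, m)] and one on [C]. *)
Lemma measurable_hit C q m (U : set (VR * VR)) :
  measurable_mapping C -> mfunv q -> measurable_fun setT m -> open U ->
  measurable [set w | exists2 y, C w y & U ((q w, m w : R^o), y)].
Proof.
move=> mC mq mm oU.
pose c (i : ('rV[rat]_n * rat) * nat) : VR := (map_mx ratr i.1.1, ratr i.1.2).
pose e (i : ('rV[rat]_n * rat) * nat) : R := i.2.+1%:R^-1.
pose W i := interior [set y | forall t, ball (c i) (e i) t -> U (t, y)].
rewrite (_ : [set _ | _] = \bigcup_i
    ([set w | ball (c i) (e i) (q w, m w : R^o)] `&` [set w | C w `&` W i !=set0])).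
  apply: countable_bigcupT_measurable => // i; apply: measurableI.
    exact: measurable_ball_preimage.
  by apply: mC; exact: open_interior.
apply/seteqP; split => w.
- move=> [y Cy]; set t := (q w, m w : R^o) => Uty.
  move: oU; rewrite openE => /(_ _ Uty) /nbhs_ballP[r /= r0 rU].
  have [k] : exists k, k.+1%:R^-1 < r / 2.
    have /ltr_add_invr[k] : 0 < r / 2 by rewrite divr_gt0.
    by rewrite add0r; exists k.
  move=> kr; have k0 : 0 < k.+1%:R^-1 :> R by rewrite invr_gt0.
  have [s st] := rational_near t k0.
  exists (s, k) => //; split => //; exists y; split => //.
  apply/nbhs_ballP; exists r => //= y' yy' t' st'; apply: rU; split => //=.
  have tt' := ball_triangle (ball_sym st) st'.
  by apply: le_ball tt'; rewrite /e/= (splitr r) lerD// ltW.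
- move=> [i _ [it [y [Cy Wy]]]]; exists y => //.
  by have := interior_subset Wy; exact.
Qed.

(** Since the epigraph is closed, [h (q w) w <= a] holds exactly when the epigraph comes within
    [1/(k+1)] of [(q w, a)] for every [k], which is a countable intersection of hitting sets. *)
Lemma measurable_fun_normal_integrand (h : 'rV[R]_n -> T -> \bar R) q :
  normal_integrand h -> mfunv q -> measurable_fun setT (fun w => h (q w) w).
Proof.
move=> [cl mh] mq; apply: (measurability _ (ErealGenOInfty.measurableE R)).
move=> /= _ [_ [a ->]] <-; apply: measurableI => //.
rewrite -[X in measurable X]setCK; apply: measurableC.
pose U k : set (VR * VR) := [set z | `|z.1 - z.2| < k.+1%:R^-1].
have oU k : open (U k).
  have cU : continuous (fun z : VR * VR => `|z.1 - z.2|).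
    move=> z; apply: cvg_norm; apply: cvgB; [exact: cvg_fst|exact: cvg_snd].
  by move: cU => /continuousP/(_ _ (@open_lt R k.+1%:R^-1)).
rewrite (_ : ~` _ = \bigcap_k
    [set w | exists2 y, epi (h ^~ w) y & U k ((q w, a : R^o), y)]).
  by apply: bigcapT_measurable => k; exact: measurable_hit.
apply/seteqP; split => w /=.
  move/negP; rewrite in_itv/= andbT -leNgt => ha k _.
  by exists (q w, a) => //; rewrite /U/= subrr normr0 invr_gt0.
move=> hw; apply/negP; rewrite in_itv/= andbT -leNgt.
suff : epi (h ^~ w) (q w, a) by [].
apply: cl => B /nbhs_ballP[r /= r0 rB].
have [k] : exists k, k.+1%:R^-1 < r.
  by have /ltr_add_invr[k] := r0; rewrite add0r; exists k.
move=> kr; have [y hy Uy] := hw k Logic.I.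
exists y; split => //; apply: rB.
by rewrite -ball_normE/=; exact: lt_trans kr.
Qed.

End measurable_mappings.

(** * Minimizing a quadratic objective over a closed convex set *)

Section quadratic_minimization.
Context {R : realType} {n : nat}.
Local Notation VR := ('rV[R]_n * R^o)%type.
Implicit Types (C : set VR) (q : 'rV[R]_n) (k m : R) (y p : VR).

Definition qobj k q m y : R :=
  dotv (y.1 - q) (y.1 - q) + k * (y.2 : R) ^+ 2 + 2 * m * (y.2 : R).

(** Half the directional derivative of [qobj] at [p] towards [y]; its nonnegativity on the set is
    the variational inequality of a minimizer. *)
Definition qvi k q m p y : R :=
  dotv (p.1 - q) (y.1 - p.1) + (k * (p.2 : R) + m) * ((y.2 : R) - (p.2 : R)).

Lemma qobjE k q m p y (t : R) :
  qobj k q m ((p.1 + t *: (y.1 - p.1)), (p.2 : R) + t * ((y.2 : R) - (p.2 : R))) =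
  qobj k q m p + 2 * t * qvi k q m p y +
  t ^+ 2 * (dotv (y.1 - p.1) (y.1 - p.1) + k * ((y.2 : R) - (p.2 : R)) ^+ 2).
Proof.
rewrite /qobj /qvi /= [p.1 + _ - q]addrAC.
move: (y.1 - p.1) (p.1 - q) => u v.
by rewrite dotvDl !dotvDr !(dotvZr, dotvZl) (dotvC u v); ring.
Qed.

Lemma qobj_shift k q m y (e : 'rV[R]_n) (t : R) :
  qobj k (q + t *: e) m y = qobj k q m y - 2 * t * dotv e (y.1 - q) +
    t ^+ 2 * dotv e e.
Proof.
rewrite /qobj opprD addrA; move: (y.1 - q) => u.
by rewrite dotvDl !dotvDr !(dotvNl, dotvNr) !(dotvZr, dotvZl) (dotvC u e); ring.
Qed.

Lemma qobj_continuous k : continuous (fun z : VR * VR => qobj k z.1.1 z.1.2 z.2).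
Proof.
have c12 (z : VR * VR) : z'.1.2 @[z' --> z] --> (z.1.2 : R).
  by apply: (@cvg_comp _ _ _ fst snd); [exact: cvg_fst|exact: cvg_snd].
have c22 (z : VR * VR) : z'.2.2 @[z' --> z] --> (z.2.2 : R).
  by apply: (@cvg_comp _ _ _ snd snd); [exact: cvg_snd|exact: cvg_snd].
have c11 (z : VR * VR) : z'.1.1 @[z' --> z] --> z.1.1.
  by apply: (@cvg_comp _ _ _ fst fst); [exact: cvg_fst|exact: cvg_fst].
have c21 (z : VR * VR) : z'.2.1 @[z' --> z] --> z.2.1.
  by apply: (@cvg_comp _ _ _ snd fst); [exact: cvg_snd|exact: cvg_fst].
move=> z; rewrite /qobj; apply: cvgD; [apply: cvgD|].
- rewrite /dotv; apply: cvg_big => [|i _]; first exact: add_continuous.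
  have cc : (fun z' : VR * VR => (z'.2.1 - z'.1.1) 0 i) z' @[z' --> z] -->
      (z.2.1 - z.1.1) 0 i.
    apply: (@cvg_comp _ _ _ (fun z' : VR * VR => z'.2.1 - z'.1.1)
      (fun u : 'rV[R]_n => u 0 i)); last exact: coord_continuous.
    by apply: cvgB; [exact: c21|exact: c11].
  exact: cvgM.
- apply: cvgM; first exact: cvg_cst.
  under eq_fun do rewrite expr2; rewrite expr2; apply: cvgM; exact: c22.
- apply: cvgM; last exact: c22.
  by apply: cvgM; [exact: cvg_cst|exact: c12].
Qed.

Lemma qobj_min_vi k q m C p : convex_set (C : set (convex_lmodType VR)) -> 0 <= k ->
  C p -> (forall y, C y -> qobj k q m p <= qobj k q m y) ->
  forall y, C y -> 0 <= qvi k q m p y.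
Proof.
move=> cC k0 Cp minp y Cy; rewrite leNgt; apply/negP => neg.
pose Q := dotv (y.1 - p.1) (y.1 - p.1) + k * ((y.2 : R) - (p.2 : R)) ^+ 2.
have Q0 : 0 <= Q by rewrite addr_ge0 ?dotvv_ge0// mulr_ge0// sqr_ge0.
pose v := qvi k q m p y; have v0 : v < 0 := neg.
have Q1 : 0 < Q + 1 - v by rewrite subr_gt0 (lt_le_trans neg)// addr_ge0.
(* This [t] lies in [(0, 1]] and satisfies [t * Q <= - v], so the change [t * (2 * v + t * Q)] of
   the objective would be negative. *)
pose t := - v / (Q + 1 - v).
have t0 : 0 < t by rewrite divr_gt0// oppr_gt0.
have t1 : t <= 1 by rewrite ler_pdivrMr// mul1r; lra.
have := cC (y : convex_lmodType VR) p (Itv01 (ltW t0) t1).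
rewrite !inE => /(_ Cy Cp) Ct.
have {}Ct : C ((p.1 + t *: (y.1 - p.1)), (p.2 : R) + t * ((y.2 : R) - (p.2 : R))).
  move: Ct; congr (C _); rewrite /conv/=.
  congr pair.
    by rewrite scalerBr [in LHS]scalerBl scale1r addrCA.
  by rewrite mulrBr [in LHS]scalerBl scale1r addrCA.
have := minp _ Ct; rewrite qobjE -/Q -/v -addrA lerDl.
rewrite (_ : _ + _ = t * (2 * v + t * Q)); last by ring.
rewrite (pmulr_rge0 _ t0).
have -> : t * Q = - v * (Q / (Q + 1 - v)) by rewrite /t mulrAC mulrA.
have : Q / (Q + 1 - v) <= 1 by rewrite ler_pdivrMr// mul1r; lra.
have neg_sum (a b : R) : b < 0 -> a <= 1 -> 0 <= 2 * b + - b * a -> False.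
  by move=> b0 a1 c0; nra.
exact: neg_sum.
Qed.

(** The expansion at [t = 1] leaves the full second-order term. Even for [k = 0] it gives quadratic
    growth in the first component, which therefore depends on [q] in a controlled way. *)
Lemma qvi_qobj_ge k q m p y : 0 <= k -> 0 <= qvi k q m p y ->
  qobj k q m p + dotv (y.1 - p.1) (y.1 - p.1) <= qobj k q m y.
Proof.
move=> k0 v0; have := qobjE k q m p y 1.
rewrite !scale1r !mul1r addrC subrK [p.2 + _]addrC subrK -surjective_pairing => ->.
rewrite expr1n mul1r mulr1.
have : 0 <= k * ((y.2 : R) - (p.2 : R)) ^+ 2 by rewrite mulr_ge0// sqr_ge0.
lra.
Qed.

Lemma qobj_min_exists k q m C (y0 : VR) (b : R) : closed C -> C y0 ->
  (forall y, C y -> qobj k q m y <= qobj k q m y0 ->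
     enorm y.1 <= b /\ `|y.2 : R| <= b) ->
  exists2 p, C p & forall y, C y -> qobj k q m p <= qobj k q m y.
Proof.
move=> clC Cy0 bd.
have cq : continuous (qobj k q m).
  move=> y; apply: (@cvg_comp _ _ _ (fun y : VR => ((q, m : R^o), y))
    (fun z : VR * VR => qobj k z.1.1 z.1.2 z.2) _ (nbhs ((q, m : R^o), y))).
    apply: (@cvg_pair _ _ _ (nbhs y) (nbhs (q, m : R^o)) (nbhs y) _ _ _
      (fun=> (q, m : R^o)) id); [exact: cvg_cst|exact: cvg_id].
  exact: (@qobj_continuous k ((q, m : R^o), y)).
pose D := C `&` [set y | qobj k q m y <= qobj k q m y0].
have cptD : compact D.
  have cpt1 : compact [set x : 'rV[R]_n | forall i, `[- b, b]%classic (x ord0 i)].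
    apply: (@rV_compact R n (fun=> `[- b, b]%classic)) => i; exact: segment_compact.
  have cpt := compact_setX cpt1 (@segment_compact R (- b) b).
  apply: (subclosed_compact _ cpt).
    apply: closedI => //.
    have := @closed_le R (qobj k q m y0).
    by move/continuous_closedP : cq; apply.
  move=> y [Cy /(bd _ Cy)[y1 y2]]; split => /= [i|].
    rewrite in_itv/= -ler_norml (le_trans (coord_le_enorm _ _))//.
  by rewrite in_itv/= -ler_norml.
have [||p] := @compact_EVT_min _ R (qobj k q m) D _ cptD.
- by exists y0; split => /=.
- exact: continuous_subspaceT.
rewrite inE => -[Cp py0] minp; exists p => // y Cy.
have [yy0|/ltW y0y] := leP (qobj k q m y) (qobj k q m y0); last exact: le_trans y0y.
by apply: minp; rewrite inE.
Qed.

End quadratic_minimization.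

(** * Measurable selection of the minimizer *)

Section measurable_minimizer.
Context {d : measure_display} {T : measurableType d} {R : realType} {n : nat}.
Local Notation VR := ('rV[R]_n * R^o)%type.
Implicit Types (C : T -> set VR) (q : T -> 'rV[R]_n) (m : T -> R).

(** Quadratic growth at [p] combined with the shift of [q] leaves the square of
    [y.1 - p.1 - t *: delta_mx 0 j] as the only remainder. *)
Lemma qobj_shift_ge (k m t : R) (q : 'rV[R]_n) (p y : VR) j :
  0 <= k -> 0 <= qvi k q m p y ->
  qobj k q m p + 2 * t * (q 0 j - p.1 0 j) <= qobj k (q + t *: delta_mx 0 j) m y.
Proof.
move=> k0 /(qvi_qobj_ge k0); rewrite qobj_shift.
have e1 : dotv (delta_mx 0 j) (delta_mx 0 j) = 1 :> R.
  by rewrite dotv_delta mxE !eqxx.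
have := dotvv_ge0 (y.1 - p.1 - t *: delta_mx 0 j).
have -> : dotv (delta_mx 0 j) (y.1 - q) =
    dotv (y.1 - p.1) (delta_mx 0 j) - (q 0 j - p.1 0 j).
  by rewrite dotvC !dotvBl !dotv_delta; ring.
move: (y.1 - p.1) => u; rewrite dotvBl !dotvBr !(dotvZl, dotvZr) e1.
by rewrite [dotv (delta_mx 0 j) u]dotvC; lra.
Qed.

Lemma measurable_fun_inf_qobj k C q m (D : set T) :
  measurable_mapping C -> mfunv q -> measurable_fun setT m -> measurable D ->
  (forall w, D w -> has_inf [set qobj k (q w) (m w) y | y in C w]) ->
  measurable_fun D (fun w => inf [set qobj k (q w) (m w) y | y in C w]).
Proof.
move=> mC mq mm mD hi _; apply: (measurability _ (RGenInftyO.measurableE R)) => //.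
move=> /= _ [_ [a ->] <-].
pose U : set (VR * VR) := [set z | qobj k z.1.1 z.1.2 z.2 < a].
rewrite (_ : _ `&` _ = D `&`
    [set w | exists2 y, C w y & U ((q w, m w : R^o), y)]).
  apply: measurableI => //; apply: measurable_hit => //.
  have := @qobj_continuous R n k.
  by move=> /continuousP/(_ _ (@open_lt R a)).
apply/seteqP; split => w [Dw]; rewrite /= in_itv/= => hw; split => //=.
  have [_ [y Cy <-] ya] := inf_lt (proj1 (hi _ Dw)) hw.
  by exists y.
case: hw => y Cy /(le_lt_trans _); apply; apply: ge_inf; last by exists y.
by have [] := hi _ Dw.
Qed.

(* The partial minimum [inf_y qobj k q m y] is differentiable in [q] with
   gradient [2 (q - eta)], so [eta] is a pointwise limit of difference
   quotients of measurable functions. *)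
Lemma measurable_argmin C k q m (D : set T) : 0 <= k ->
  measurable_mapping C -> (forall w, convex_set (C w : set (convex_lmodType VR))) ->
  measurable D -> mfunv q -> measurable_fun setT m ->
  (forall w, D w -> exists2 p, C w p &
     forall y, C w y -> qobj k (q w) (m w) p <= qobj k (q w) (m w) y) ->
  exists2 eta : T -> 'rV[R]_n, mfunv eta & forall w, D w -> exists2 a : R^o,
    C w (eta w, a) & forall y, C w y -> 0 <= qvi k (q w) (m w) (eta w, a) y.
Proof.
move=> k0 mC cC mD mq mm minD.
have /choice[p pP] : forall w, exists p : VR, D w -> C w p /\
    forall y, C w y -> 0 <= qvi k (q w) (m w) p y.
  move=> w; have [Dw|nDw] := pselect (D w); last by exists (0, 0).
  have [p Cp minp] := minD w Dw; exists p => _; split => //.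
  exact: qobj_min_vi.
(* The value 0 outside [D] reduces measurability to measurability on [D]. *)
pose eta w : 'rV[R]_n := \row_j ((fun w => (p w).1 0 j) \_ D) w.
have etaE w : D w -> eta w = (p w).1.
  by move=> Dw; apply/rowP => j; rewrite mxE patchE mem_set.
exists eta => [j|w Dw]; last first.
  exists (p w).2; rewrite etaE// -surjective_pairing; first by case: (pP w Dw).
  by case: (pP w Dw).
rewrite (_ : (fun _ => _) = (fun w => (p w).1 0 j) \_ D); last first.
  by apply/funext => w; rewrite mxE.
apply: (proj1 (measurable_restrictT _ mD)).
pose u (t : R) w := q w + t *: delta_mx 0 j : 'rV[R]_n.
have mu t : mfunv (u t).
  move=> i; rewrite (_ : (fun _ => _) = (fun w => q w 0 i + t * (delta_mx 0 j : 'rV[R]_n) 0 i)).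
    by apply: measurable_funD => //; exact: measurable_cst.
  by apply/funext => w; rewrite !mxE.
pose S t w := [set qobj k (u t w) (m w) y | y in C w].
have Slb t w : D w ->
    lbound (S t w) (qobj k (q w) (m w) (p w) + 2 * t * (q w 0 j - (p w).1 0 j)).
  move=> Dw _ [y Cy <-]; apply: qobj_shift_ge => //.
  by case: (pP w Dw) => _; apply.
have Sinf t w : D w -> has_inf (S t w).
  move=> Dw; split; last by eexists; exact: Slb.
  by case: (pP w Dw) => Cp _; exists (qobj k (u t w) (m w) (p w)); exists (p w).
pose Phi t w := inf (S t w).
have mPhi t : measurable_fun D (Phi t).
  by apply: measurable_fun_inf_qobj => // w; exact: Sinf.
(* Together with [Phile], where [p w] is the competitor, this puts [Phi t - Phi 0 - 2 t (q_j - p_j)]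
   between 0 and [t ^+ 2]. The quotient by [2 t] thus misses [q_j - p_j] by at most [t / 2]. *)
have Phige t w : D w ->
    qobj k (q w) (m w) (p w) + 2 * t * (q w 0 j - (p w).1 0 j) <= Phi t w.
  by move=> Dw; apply: lb_le_inf; [case: (Sinf t w Dw)|exact: Slb].
have Phile t w : D w -> Phi t w <=
    qobj k (q w) (m w) (p w) + 2 * t * (q w 0 j - (p w).1 0 j) + t ^+ 2.
  move=> Dw; apply: (@le_trans _ _ (qobj k (u t w) (m w) (p w))).
    apply: ge_inf; first by case: (Sinf t w Dw).
    by exists (p w) => //; case: (pP w Dw).
  rewrite /u qobj_shift dotv_delta mxE !eqxx/= dotvC !dotvBl !dotv_delta; lra.
pose t i : R := i.+1%:R^-1.
have t0 i : 0 < t i by rewrite invr_gt0.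
apply: (@measurable_fun_cvg _ _ _ _
  (fun i w => q w 0 j - (Phi (t i) w - Phi 0 w) / (2 * t i))) => [i|w Dw].
  apply: measurable_funB; first exact: measurable_funTS.
  apply: (@measurable_funM _ _ _ _ (Phi (t i) \- Phi 0) (cst (2 * t i)^-1)).
    by apply: measurable_funB; exact: mPhi.
  exact: measurable_cst.
have PhiE : Phi 0 w = qobj k (q w) (m w) (p w).
  by apply/le_anti/andP; split; [have := Phile 0 w Dw|have := Phige 0 w Dw]; lra.
apply/cvgrPdist_le => /= e e0.
have tcvg : t i @[i --> \oo] --> 0 := cvg_harmonic.
move/cvgrPdist_le : tcvg => /(_ _ e0); apply: filterS => i /=.
rewrite sub0r normrN gtr0_norm// => tie.
have ti0 := t0 i; have := Phige (t i) w Dw; have := Phile (t i) w Dw.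
rewrite PhiE; set c := q w 0 j - _; set a := qobj _ _ _ _; set b := Phi _ _ => b1 b2.
rewrite (_ : _ - _ = (b - a) / (2 * t i) - c); last by rewrite /c; ring.
have t2 : 0 < 2 * t i by rewrite mulr_gt0.
rewrite (_ : _ - c = (b - a - 2 * t i * c) / (2 * t i)); last first.
  by field; rewrite gt_eqF.
rewrite ger0_norm; last by rewrite divr_ge0 ?(ltW t2)//; lra.
rewrite ler_pdivrMr//; apply: (@le_trans _ _ (t i ^+ 2)); first lra.
rewrite expr2; nra.
Qed.

End measurable_minimizer.

(** * Integrals under almost everywhere comparison, and elements of L^oo and L^1 *)

Section ae_integrals.
Context {d : measure_display} {T : measurableType d} {R : realType}.
Variable P : probability T R.
Implicit Types f g : T -> \bar R.
Local Open Scope ereal_scope.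

Lemma ae_le_integrable f g : measurable_fun setT f ->
  (\forall w \ae P, `|f w| <= `|g w|) ->
  P.-integrable setT g -> P.-integrable setT f.
Proof.
move=> mf fg /integrableP[mg goo]; apply/integrableP; split => //.
apply: le_lt_trans goo; apply: ae_ge0_le_integral => //.
- exact: measurableT_comp.
- exact: measurableT_comp.
- by apply: filterS fg.
Qed.

Lemma ae_le_integral f g : P.-integrable setT f -> P.-integrable setT g ->
  (\forall w \ae P, f w <= g w) -> \int[P]_w f w <= \int[P]_w g w.
Proof.
move=> intf intg fg.
have mf : measurable_fun setT f by case/integrableP : intf.
have mg : measurable_fun setT g by case/integrableP : intg.
(* Replacing [g] by this function, equal to it almost everywhere, makes the inequality hold at every
   point. *)
pose k w := maxe (f w) (g w).
have mk : measurable_fun setT k by exact: measurable_maxe.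
have kg : ae_eq P setT g k.
  by apply: filterS fg => w fgw _; rewrite /k max_r.
have intk : P.-integrable setT k.
  apply: ae_le_integrable intg => //.
  by apply: filterS kg => w /(_ Logic.I) ->.
rewrite [leRHS](ae_eq_integral k)//.
by apply: le_integral => // w _; rewrite /k le_max lexx.
Qed.

Lemma integrable_bounded (f : T -> R) (M : R) : measurable_fun setT f ->
  (\forall w \ae P, (`|f w| <= M)%R) -> P.-integrable setT (EFin \o f).
Proof.
move=> mf fM; apply: (@ae_le_integrable _ (cst M%:E)).
- exact/measurable_EFinP.
- by apply: filterS fM => w fM; rewrite /= lee_fin (le_trans fM)// ler_norm.
- exact: finite_measure_integrable_cst.
Qed.

End ae_integrals.

Section Lp_elements.
Context {d : measure_display} {T : measurableType d} {R : realType}.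
Variables (P : probability T R) (n : nat).
Implicit Types (f : T -> 'rV[R]_n) (x z : Linf P n) (v : Lone P n).

Lemma Lnorm_infty (f : T -> R) :
  'N[P]_+oo[EFin \o f]%E = ess_sup P (abse \o (EFin \o f)).
Proof. by rewrite unlock /= probability_setT lte01. Qed.

Lemma Linf_ae_le x : \forall w \ae P, enorm (x w) <= `|x|.
Proof.
have := Lp_normE x; rewrite Lnorm_infty => xE.
have := ess_sup_ge P (abse \o (EFin \o (enorm \o x))); rewrite -xE.
by apply: filterS => w /=; rewrite lee_fin ger0_norm// enorm_ge0.
Qed.

Lemma Linf_norm_le x (M : R) : (\forall w \ae P, enorm (x w) <= M) -> `|x| <= M.
Proof.
move=> xM; rewrite -lee_fin (_ : `|x|%:E = 'N[P]_+oo[EFin \o (enorm \o x)]%E).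
  rewrite Lnorm_infty; apply/ess_supP; apply: filterS xM => w.
  by rewrite /= lee_fin ger0_norm// enorm_ge0.
exact: Lp_normE.
Qed.

Lemma Linf_ex f (M : R) : mfunv f -> (\forall w \ae P, enorm (f w) <= M) ->
  exists x : Linf P n, \forall w \ae P, x w = f w.
Proof.
move=> mf fM; have fL : f \in Lpfun P (leey 1%E).
  apply/LpfunP; split => //; rewrite /finite_norm Lnorm_infty.
  apply: (@le_lt_trans _ _ M%:E); last exact: ltry.
  apply/ess_supP; apply: filterS fM => w.
  by rewrite /= lee_fin ger0_norm// enorm_ge0.
exists (Lp_class (MkLpfun fL)); exact: (Lp_fun_class (MkLpfun fL)).
Qed.

Lemma Lone_ex f : mfunv f -> P.-integrable setT (EFin \o (enorm \o f)) ->
  exists v : Lone P n, \forall w \ae P, v w = f w.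
Proof.
move=> mf /integrableP[_ fi]; have fL : f \in Lpfun P (lexx 1%E).
  by apply/LpfunP; split => //; rewrite /finite_norm Lnorm1.
exists (Lp_class (MkLpfun fL)); exact: (Lp_fun_class (MkLpfun fL)).
Qed.

Lemma Lone_integrable v : P.-integrable setT (EFin \o (enorm \o v)).
Proof.
apply/integrableP; split; first exact/measurable_EFinP/mfunv_enorm/mfunv_Lp.
by have := finite_norm_Lp v; rewrite /finite_norm Lnorm1.
Qed.

Lemma measurable_dotv f (g : T -> 'rV[R]_n) : mfunv f -> mfunv g ->
  measurable_fun setT (fun w => dotv (f w) (g w)).
Proof. by move=> mf mg; apply: measurable_sum => i; exact: measurable_funM. Qed.

Lemma integrable_dotv f (g : T -> 'rV[R]_n) (M : R) : mfunv f -> mfunv g ->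
  (\forall w \ae P, enorm (f w) <= M) ->
  P.-integrable setT (EFin \o (enorm \o g)) ->
  P.-integrable setT (fun w => (dotv (f w) (g w))%:E).
Proof.
move=> mf mg fM ig.
apply: (@ae_le_integrable _ _ _ _ _ (fun w => M%:E * (enorm (g w))%:E)%E).
- exact/measurable_EFinP/measurable_dotv.
- apply: filterS fM => w fM /=.
  rewrite lee_fin normrM (le_trans (dotv_norm_le _ _))//.
  rewrite ler_pM ?enorm_ge0 ?ler_norm//; first by rewrite (le_trans fM) ?ler_norm.
- exact: integrableZl.
Qed.

Lemma pairingE z v : (pairing z v)%:E = (\int[P]_w (dotv (z w) (v w))%:E)%E.
Proof.
rewrite /pairing /Rintegral fineK//; apply: integrable_fin_num => //.
apply: (integrable_dotv (M := `|z|)); [exact: mfunv_Lp..|exact: Linf_ae_le|].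
exact: Lone_integrable.
Qed.

End Lp_elements.

(** * The integral functional: finiteness, comparison and convexity *)

Section integral_functional.
Context {d : measure_display} {T : measurableType d} {R : realType}.
Context {P : probability T R} {n : nat} {h : 'rV[R]_n -> T -> \bar R}.
Hypothesis nh : normal_integrand h.
Hypothesis Eint_neqNy : forall x : Linf P n, Eint P h x != -oo%E.
Implicit Types x y : Linf P n.
Local Open Scope ereal_scope.

Lemma measurable_integrand x : measurable_fun setT (fun w => h (x w) w).
Proof. by apply: measurable_fun_normal_integrand nh _; exact: mfunv_Lp. Qed.

(** A value below [+oo] makes the positive part integrable; a negative part of infinite integral
    would give the excluded value [-oo]. *)
Lemma Eint_lty_integrable x : Eint P h x < +oo ->
  P.-integrable setT (fun w => h (x w) w) /\
  Eint P h x = \int[P]_w h (x w) w.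
Proof.
have := Eint_neqNy x; rewrite /Eint /expect; case: asboolP => //.
set f := fun w => h (x w) w => ip fNy _; split => //.
have mf : measurable_fun setT f := measurable_integrand x.
have mp : measurable_fun setT f^\+ by exact: measurable_funepos.
have mn : measurable_fun setT f^\- by exact: measurable_funeneg.
have fp : \int[P]_w f^\+ w < +oo.
  case/integrableP : ip => _; congr (_ < _); apply: eq_integral => w _.
  by rewrite gee0_abs.
have fn : \int[P]_w f^\- w < +oo.
  rewrite ltey; apply: contra fNy => /eqP fny; rewrite integralE fny.
  by rewrite addeNy.
apply/integrableP; split => //.
under eq_integral do rewrite -/((abse \o f) _) fune_abse.
by rewrite ge0_integralD// lte_add_pinfty.
Qed.

(** The integrable majorant controls the positive part of [h (x w) w], so [expect] takes its
    integral branch and stays below [+oo]; the integrals can then be compared. *)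
Lemma Eint_le x (g : T -> \bar R) : P.-integrable setT g ->
  (\forall w \ae P, h (x w) w <= g w) -> Eint P h x <= \int[P]_w g w.
Proof.
move=> ig hg.
have mf := measurable_integrand x.
have ip : P.-integrable setT ((fun w => h (x w) w)^\+).
  apply: ae_le_integrable ig; first exact: measurable_funepos.
  apply: filterS hg => w hg; rewrite gee0_abs//= funeposE ge_max abse_ge0 andbT.
  by rewrite (le_trans hg)// lee_abs.
have fin : Eint P h x < +oo.
  rewrite /Eint /expect asboolT// integralE.
  have /(integrable_fin_num measurableT) := ip.
  rewrite ge0_fin_numE ?integral_ge0// => ipoo.
  apply: le_lt_trans ipoo.
  by rewrite -[leRHS]adde0 leeD2l// oppe_le0 integral_ge0.
have [ih ->] := Eint_lty_integrable fin.
exact: ae_le_integral.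
Qed.

Lemma Eint_ge x (g : T -> \bar R) : P.-integrable setT g ->
  (\forall w \ae P, g w <= h (x w) w) -> \int[P]_w g w <= Eint P h x.
Proof.
move=> ig gh; have [xy|] := eqVneq (Eint P h x) +oo; first by rewrite xy leey.
rewrite -ltey => /Eint_lty_integrable[ih ->]; exact: ae_le_integral.
Qed.

Lemma Eint_fin x : Eint P h x < +oo ->
  \forall w \ae P, h (x w) w \is a fin_num.
Proof.
move=> /Eint_lty_integrable[/(integrable_ae measurableT) + _].
by apply: filterS => w; apply.
Qed.

Lemma sub_edom_Eint : edom (Eint P h) `<=` Linf_sel P (fun w => edom (h ^~ w)).
Proof.
by move=> x /Eint_fin; apply: filterS => w; rewrite fin_numElt => /andP[].
Qed.

Lemma Eint_convex : (forall w, convex_fun (h ^~ w)) -> convex_fun (Eint P h).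
Proof.
move=> ch; apply/convex_funP => x y a b t t01 xa yb.
have [ix xE] := Eint_lty_integrable (le_lt_trans xa (ltry _)).
have [iy yE] := Eint_lty_integrable (le_lt_trans yb (ltry _)).
have finx := Eint_fin (le_lt_trans xa (ltry _)).
have finy := Eint_fin (le_lt_trans yb (ltry _)).
have itx := integrableZl measurableT t ix.
have ity := integrableZl measurableT (1 - t)%R iy.
apply: le_trans (Eint_le (integrableD measurableT itx ity) _) _.
  apply: filterS3 (filterI finx finy) (Lp_funD (t *: x)%R ((1 - t) *: y)%R)
    (filterI (Lp_funZ t x) (Lp_funZ (1 - t)%R y)) => w [fx fy] -> [tx ty].
  rewrite tx ty -(fineK fx) -(fineK fy) -!EFinM -EFinD.
  by apply: (proj1 (convex_funP _) (ch w)) => //; rewrite fineK.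
rewrite integralD//= !integralZl// -xE -yE [leRHS]EFinD !EFinM.
by case/andP : t01 => t0 t1; rewrite leeD// lee_wpmul2l// lee_fin subr_ge0.
Qed.

End integral_functional.

(** * Relative interiors, and affine selections in L^oo *)

Lemma rintP {R : realType} {V : normedModType R} (C : set V) (x : V) :
  rint C x <-> C x /\ exists2 e : R, 0 < e &
    forall y, affine_hull C y -> `|y - x| < e -> C y.
Proof.
(* A point of [C] lies in the hull, where subspace neighbourhoods are traces of norm
   neighbourhoods. *)
have nE : C x -> @nbhs _ (subspace (affine_hull C)) x =
    within (affine_hull C) (nbhs x).
  by move=> Cx; rewrite (nbhs_subspace_in (@sub_affine_hull _ _ C x Cx)).
rewrite /rint /interior/=; split.
  move=> nCx; have Cx := nbhs_singleton nCx; split => //.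
  move: nCx; rewrite (nE Cx).
  rewrite /within/= => /nbhs_ballP[e /= e0 eC]; exists e => // y Ay yx.
  by apply: eC => //; rewrite -ball_normE/= distrC.
move=> [Cx [e e0 eC]].
rewrite (nE Cx).
apply/nbhs_ballP; exists e => //= y; rewrite -ball_normE/= distrC => yx Ay.
exact: eC.
Qed.

Lemma affine_comb_subl {R : realType} {V : lmodType R} (x y : V) (t : R) :
  (1 - t) *: x + t *: y - x = t *: (y - x).
Proof.
by rewrite scalerBl scale1r scalerBr addrAC [x - _ - x]addrAC subrr add0r addrC.
Qed.

Section relative_interior.
Context {d : measure_display} {T : measurableType d} {R : realType}.
Context {P : probability T R} {n : nat}.
Implicit Types (x y z : Linf P n) (A : T -> set 'rV[R]_n).

Lemma Linf_funB x y : \forall w \ae P, (x - y : Linf P n) w = x w - y w.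
Proof.
apply: filterS2 (Lp_funD x (- y)) (Lp_funZ (-1) y) => w ->.
by rewrite !scaleN1r => ->.
Qed.

Lemma Linf_dist_ae_le x y : \forall w \ae P, enorm (x w - y w) <= `|x - y|.
Proof. by apply: filterS2 (Linf_funB x y) (Linf_ae_le (x - y)) => w ->. Qed.

Lemma Linf_fun_affine x y (t : R) : \forall w \ae P,
  ((1 - t) *: x + t *: y : Linf P n) w = (1 - t) *: x w + t *: y w.
Proof.
apply: filterS3 (Lp_funD ((1 - t) *: x) (t *: y)) (Lp_funZ (1 - t) x)
  (Lp_funZ t y) => w -> -> -> //.
Qed.

Lemma Linf_sel_affine A : (forall w, affine_set (A w)) -> affine_set (Linf_sel P A).
Proof.
move=> aA x y t Ax Ay.
by apply: filterS3 (Linf_fun_affine x y t) Ax Ay => w -> Ax Ay; exact: aA.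
Qed.

(** A sequence approaching [x] in norm does so pointwise off one null set, being countable, and each
    [A w] is closed as an affine set of finite dimension. *)
Lemma Linf_sel_closed A : (forall w, affine_set (A w)) -> closed (Linf_sel P A).
Proof.
move=> aA x clx.
have approx k : exists y, Linf_sel P A y /\ `|x - y| < k.+1%:R^-1.
  have k0 : 0 < k.+1%:R^-1 :> R by rewrite invr_gt0.
  have [y [Ay]] := clx _ (nbhsx_ballx x _ k0).
  by rewrite -ball_normE/= => xy; exists y.
have /choice[y yP] := approx.
have Ay := ae_foralln (fun k => proj1 (yP k)).
have dy := ae_foralln (fun k => Linf_dist_ae_le x (y k)).
apply: filterS2 Ay dy => w Ay dy; apply: affine_set_closed => // e e0.
have [k] : exists k, k.+1%:R^-1 < e.
  by have /ltr_add_invr[k] := e0; rewrite add0r; exists k.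
move=> ke; exists (y k w); first exact: Ay.
by rewrite (le_lt_trans (dy k))// (lt_trans (proj2 (yP k))).
Qed.

End relative_interior.

(** * Affine hull and relative interior of the domain *)

Section D_set.
Context {d : measure_display} {T : measurableType d} {R : realType}.
Context {P : probability T R} {n : nat} {h : 'rV[R]_n -> T -> \bar R}.
Hypothesis nh : convex_normal_integrand h.
Hypothesis Eint_neqNy : forall x : Linf P n, Eint P h x != -oo%E.
Hypothesis Dset_edom : Dset P h `<=` edom (Eint P h).
Implicit Types x y z : Linf P n.

Let A w := affine_hull (edom (h ^~ w)).

Definition Dset_radius (r : R) x := 0 < r /\ Linf_sel P (fun w => edom (h ^~ w)) x /\
  \forall w \ae P, eball (x w) r `&` A w `<=` edom (h ^~ w).

Lemma Dset_radiusP x : Dset P h x <-> exists r, Dset_radius r x.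
Proof.
split=> [[xdom [r r0 rx]]|[r [r0 [xdom rx]]]]; first by exists r.
by split => //; exists r.
Qed.

(** Half of the radius covers the distance from [x] to [y]; the other half remains as a radius for
    [y]. *)
Lemma Dset_radius_near r x y : Dset_radius r x -> Linf_sel P A y ->
  `|y - x| <= r / 2 -> Dset P h y.
Proof.
move=> [r0 [_ rx]] Ay yx; have r20 : 0 < r / 2 by rewrite divr_gt0.
split.
  apply: filterS3 rx Ay (Linf_dist_ae_le y x) => w rx Ay dyx; apply: rx; split => //.
  by rewrite /eball/= (le_trans dyx)// (le_trans yx)//; lra.
exists (r / 2) => //.
apply: filterS2 rx (Linf_dist_ae_le y x) => w rx dyx u [uy Au]; apply: rx; split => //.
rewrite /eball/= in uy *.
rewrite (_ : u - x w = (u - y w) + (y w - x w)); last by rewrite addrA subrK.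
by rewrite (le_trans (enormD _ _))// (splitr r) lerD// (le_trans dyx).
Qed.

Lemma Dset_affine x : Dset P h x -> Linf_sel P A x.
Proof. by move=> [xdom _]; apply: filterS xdom => w; exact: sub_affine_hull. Qed.

Lemma Dset_radius_segment r x y : Dset_radius r x -> Linf_sel P A y ->
  exists2 t, 0 < t & Dset P h ((1 - t) *: x + t *: y).
Proof.
move=> rx Ay; have [r0 _] := rx.
have xA : Linf_sel P A x by apply/Dset_affine/Dset_radiusP; exists r.
pose t := r / 2 / (`|y - x| + 1).
have yx1 : 0 < `|y - x| + 1 by rewrite ltr_wpDl.
have t0 : 0 < t by rewrite !divr_gt0.
exists t => //; apply: (Dset_radius_near rx).
  by apply: Linf_sel_affine => // w; exact: affine_hull_affine.
rewrite affine_comb_subl normrZ gtr0_norm//.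
rewrite /t mulrAC ler_pdivrMr// ler_pM2l ?divr_gt0//.
by rewrite lerDl.
Qed.

(** For the larger inclusion, any [y] in L^oo(A) lies on the line through [x0] and a point of D on
    the segment from [x0] to [y]; both are in the domain. *)
Lemma affine_hull_edom_Eint : Dset P h !=set0 ->
  affine_hull (edom (Eint P h)) = Linf_sel P A.
Proof.
move=> [x0 Dx0]; apply/seteqP; split.
  apply: affine_hull_min => [|x /(sub_edom_Eint (proj1 nh) Eint_neqNy)].
    by apply: Linf_sel_affine => w; exact: affine_hull_affine.
  by apply: filterS => w; exact: sub_affine_hull.
move=> y Ay; have [r rx0] := proj1 (Dset_radiusP x0) Dx0.
have [t t0 Dt] := Dset_radius_segment rx0 Ay.
have := affine_hull_affine t^-1 (sub_affine_hull (Dset_edom Dx0))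
  (sub_affine_hull (Dset_edom Dt)).
congr (affine_hull _ _).
rewrite scalerDr !scalerA mulVf ?gt_eqF// scale1r mulrBr mulr1 mulVf ?gt_eqF//.
by rewrite addrA -scalerDl addrA subrK subrr scale0r add0r.
Qed.

(** From a relative interior point [x], the segment from [x0] can be prolonged slightly beyond [x]
    to some [y] in the domain. Then [x] is a convex combination of [x0] and [y], and convexity
    transports the ball around [x0(w)] to a ball around [x(w)] with radius scaled by the weight
    [s]. *)
Lemma rint_edom_Eint : Dset P h !=set0 -> rint (edom (Eint P h)) = Dset P h.
Proof.
move=> D0; have affE := affine_hull_edom_Eint D0; have [x0 Dx0] := D0.
apply/seteqP; split => x; last first.
  move=> Dx; apply/rintP; split; first exact: Dset_edom.
  have [r rx] := proj1 (Dset_radiusP x) Dx; have [r0 _] := rx.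
  exists (r / 2); first by rewrite divr_gt0.
  rewrite affE => y Ay /ltW yx; apply: Dset_edom.
  exact: Dset_radius_near yx.
move=> /rintP[xdom [e e0 ex]].
have xA : Linf_sel P A x by rewrite -affE; exact: sub_affine_hull.
have x0A := Dset_affine Dx0.
have [r [r0 [_ rx0]]] := proj1 (Dset_radiusP x0) Dx0.
(* Chosen so that [y = x + t (x - x0)] has distance at most [e / 2] from [x]. *)
pose t := e / 2 / (`|x - x0| + 1).
have xx1 : 0 < `|x - x0| + 1 by rewrite ltr_wpDl.
have t0 : 0 < t by rewrite !divr_gt0.
pose y : Linf P n := (1 - - t) *: x + (- t) *: x0.
have ydom : edom (Eint P h) y.
  apply: ex.
    rewrite affE; apply: Linf_sel_affine => // w; exact: affine_hull_affine.
  rewrite /y affine_comb_subl normrZ normrN gtr0_norm// distrC /t mulrAC ltr_pdivrMr//.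
  rewrite (@le_lt_trans _ _ (e / 2 * (`|x - x0| + 1)))//.
    by rewrite ler_pM2l ?divr_gt0// lerDl.
  by rewrite ltr_pM2r//; lra.
have t10 : 0 < 1 + t by rewrite addr_gt0.
(* The weight for which [x = s x0 + (1 - s) y]. *)
pose s := t / (1 + t).
have s0 : 0 < s by rewrite divr_gt0.
have s01 : 0 <= s <= 1.
  by rewrite ltW//= /s ler_pdivrMr// mul1r lerDr.
have rs0 : 0 < r * s by rewrite mulr_gt0.
have xsel := sub_edom_Eint (proj1 nh) Eint_neqNy xdom.
have ysel := sub_edom_Eint (proj1 nh) Eint_neqNy ydom.
split => //; exists (r * s) => //.
apply: filterS3 (filterI ysel rx0) (filterI (Linf_fun_affine x x0 (- t)) xsel) x0A.
move=> w [yw rx0w] [yE xw] x0w u [ux Au].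
rewrite /eball/= in ux.
(* u = s v + (1 - s) y(w) with v in the ball around x0(w) *)
pose v := x0 w + s^-1 *: (u - (x : Linf P n) w).
have vdom : edom (h ^~ w) v.
  apply: rx0w; split.
    rewrite /eball/= /v [x0 w + _]addrC addrK enormZ gtr0_norm ?invr_gt0//.
    by rewrite mulrC ler_pdivrMr.
  rewrite /v; apply: (@affine_setD _ _ (A w)) => //.
    exact: affine_hull_affine.
  exact: (sub_affine_hull xw).
have -> : u = s *: v + (1 - s) *: y w.
  rewrite /y yE /v scalerDr scalerA mulfV ?gt_eqF// scale1r.
  rewrite opprK scalerDr !scalerA.
  rewrite (_ : (1 - s) * (1 + t) = 1); last by rewrite /s; field; rewrite gt_eqF.
  rewrite (_ : (1 - s) * - t = - s); last by rewrite /s; field; rewrite gt_eqF.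
  by rewrite scale1r scaleNr [_ - s *: _]addrC addrACA subrr add0r subrK.
have := proj1 (convex_funP _) (proj2 nh w) _ _ _ _ _ s01
  (lty_le_fine vdom) (lty_le_fine yw).
by move=> /le_lt_trans; apply; exact: ltry.
Qed.

End D_set.

(** * Measurable choice of an index *)

Section measurable_choice.
Context {d : measure_display} {T : measurableType d} {R : realType}.

(** The least admissible index has measurable level sets [W k] minus the earlier [W j].
    Measurability of [i] is expressed through composition with sequences of functions, the form in
    which it is applied. *)
Lemma measurable_first_index (Z : nat -> set T) : (forall k, measurable (Z k)) ->
  exists i : T -> nat, (forall w, (exists k, Z k w) -> Z (i w) w) /\
    forall f : nat -> T -> R, (forall k, measurable_fun setT (f k)) ->
      measurable_fun setT (fun w => f (i w) w).
Proof.
(* The added complement gives every [w] an index, namely 0 where no [Z k] holds. *)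
move=> mZ; pose W k := Z k `|` ~` \bigcup_j Z j.
have mW k : measurable (W k).
  by apply: measurableU => //; apply/measurableC/bigcupT_measurable.
have exW w : exists k, `[< W k w >].
  have [[k _ Zk]|nZ] := pselect ((\bigcup_j Z j) w).
    by exists k; apply/asboolP; left.
  by exists 0%N; apply/asboolP; right.
pose i w := ex_minn (exW w).
have iP w : W (i w) w by rewrite /i; case: ex_minnP => k /asboolP.
have imin w k : W k w -> (i w <= k)%N.
  by rewrite /i; case: ex_minnP => k' _ kmin Wk; apply/kmin/asboolP.
have iE k : i @^-1` [set k] = W k `&` \bigcap_(j in `I_k) ~` W j.
  apply/seteqP; split => w /=.
    move=> <-; split; first exact: iP.
    by move=> j /= ji /imin; rewrite leqNgt ji.
  move=> [Wk nW]; apply/eqP; rewrite eqn_leq imin//= leqNgt; apply/negP => ik.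
  exact: (nW _ ik (iP w)).
exists i; split => [w [k Zk]|f mf _ Y mY].
  by case: (iP w) => // nZ; exfalso; apply: nZ; exists k.
rewrite setTI (_ : _ @^-1` _ = \bigcup_k (i @^-1` [set k] `&` (f k @^-1` Y))).
  apply: bigcupT_measurable => k; apply: measurableI; last first.
    by rewrite -[X in measurable X]setTI; exact: mf.
  rewrite iE; apply: measurableI => //; apply: fin_bigcap_measurable => [|j _].
    exact: finite_II.
  exact: measurableC.
apply/seteqP; split => w /=; first by exists (i w).
by move=> [k _ [/= -> ]].
Qed.

End measurable_choice.

(** * Local boundedness and relative continuity on D *)

Section continuity.
Context {d : measure_display} {T : measurableType d} {R : realType}.
Context {P : probability T R} {n : nat} {h : 'rV[R]_n -> T -> \bar R}.
Hypothesis nh : convex_normal_integrand h.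
Hypothesis Eint_neqNy : forall x : Linf P n, Eint P h x != -oo%E.
Hypothesis Dset_edom : Dset P h `<=` edom (Eint P h).
Implicit Types x y z : Linf P n.

Let A w := affine_hull (edom (h ^~ w)).

(** All but finitely many [y k] lie in the neighbourhood where [convex_fun_locally_bounded] applies,
    and the others have values below [+oo]. *)
Lemma convex_fun_bounded_along w (x : 'rV[R]_n) (y : nat -> 'rV[R]_n) (r : R) :
  0 < r -> A w x -> eball x r `&` A w `<=` edom (h ^~ w) ->
  (forall k, A w (y k) /\ enorm (y k - x) <= r / k.+1%:R) ->
  exists B : R, forall k, (h (y k) w <= B%:E)%E.
Proof.
move=> r0 Ax rx yP.
have [|M [delta delta0 MP]] := convex_fun_locally_bounded (proj2 nh w)
  (@affine_hull_affine _ _ _) Ax r0.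
  by move=> u Au ux; apply: rx.
have [N Ndelta] : exists N, r / N.+1%:R < delta.
  have /ltr_add_invr[N] : 0 < delta / r by rewrite divr_gt0.
  by rewrite add0r ltr_pdivlMr// mulrC => ?; exists N.
have ylt k : (h (y k) w < +oo)%E.
  have [Ay yx] := yP k; apply: rx; split => //; rewrite /eball/= (le_trans yx)//.
  by rewrite ler_pdivrMr// ler_peMr ?(ltW r0)// ler1n.
exists (`|M| + \sum_(k < N) `|fine (h (y k) w)|) => k.
have [kN|Nk] := ltnP k N.
  rewrite (le_trans (lty_le_fine (ylt k)))// lee_fin (bigD1 (Ordinal kN))//=.
  by rewrite addrCA lerDl addr_ge0// sumr_ge0.
have [Ay yx] := yP k; rewrite (le_trans (MP _ Ay _))//.
  rewrite (le_trans yx)// (le_trans _ (ltW Ndelta))//.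
  by rewrite ler_pM2l// lef_pV2 ?posrE// ler_nat ltnS.
by rewrite lee_fin (le_trans (ler_norm _))// lerDl sumr_ge0.
Qed.

(* If Eint were unbounded near x along y_k -> x, then the pointwise almost
   maximal selection among the y_k would lie in D with infinite Eint. *)
Lemma Eint_locally_bounded x : Dset P h x ->
  exists M : R, exists2 delta, 0 < delta & forall y, Linf_sel P A y ->
    `|y - x| <= delta -> (Eint P h y <= M%:E)%E.
Proof.
move=> Dx; have [r rx] := proj1 (Dset_radiusP x) Dx.
have [r0 [_ rball]] := rx; have r20 : 0 < r / 2 by rewrite divr_gt0.
apply: contrapT => nbd.
have /choice[y yP] : forall k : nat, exists y, [/\ Linf_sel P A y,
    `|y - x| <= r / 2 / k.+1%:R & ~ (Eint P h y <= k%:R%:E)%E].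
  move=> k; apply: contrapT => ny; apply: nbd.
  exists k%:R, (r / 2 / k.+1%:R); first by rewrite divr_gt0.
  move=> y Ay yx; apply: contrapT => hy; apply: ny; exists y; split => //.
have rk k : r / 2 / k.+1%:R <= r / 2.
  by rewrite ler_pdivrMr// ler_peMr ?(ltW r20)// ler1n.
have yfin k : (Eint P h (y k) < +oo)%E.
  have [Ay yx _] := yP k; apply: Dset_edom; apply: (Dset_radius_near rx) => //.
  exact: le_trans (rk k).
pose f k w := fine (h (y k w) w).
have mf k : measurable_fun setT (f k).
  by apply: measurableT_comp => //; exact: measurable_integrand (proj1 nh) _.
(* Here [k] is an index whose value is within 1 of the supremum over all indices. *)
pose Z k := \bigcap_j [set w | f j w <= f k w + 1].
have mZ k : measurable (Z k).
  apply: bigcapT_measurable => j; rewrite -[X in measurable X]setTI.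
  have : measurable_fun setT (fun w => f j w <= f k w + 1).
    by apply: measurable_fun_ler => //; exact: measurable_funD.
  by move=> /(_ measurableT [set true]); apply.
have [i [iZ imeas]] := measurable_first_index (R := R) mZ.
have myi : mfunv (fun w => y (i w) w).
  by move=> j; apply: (imeas (fun k w => y k w 0 j)) => k; exact: mfunv_Lp.
have yA := ae_foralln (fun k => let: And3 p _ _ := yP k in p).
have yd := ae_foralln (fun k => Linf_dist_ae_le (y k) x).
have yf := ae_foralln (fun k => Eint_fin (proj1 nh) Eint_neqNy (yfin k)).
have xA := Dset_affine Dx.
have ydk w : (forall k, enorm (y k w - x w) <= `|y k - x|) ->
    forall k, enorm (y k w - x w) <= r / 2 / k.+1%:R.
  by move=> ydw k; have [_ yx _] := yP k; exact: le_trans yx.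
have selZ : \forall w \ae P, Z (i w) w.
  apply: filterS3 (filterI yA yd) yf (filterI xA rball) => w [yAw ydw] yfw [xAw rw].
  apply: iZ.
  have [||B BP] := @convex_fun_bounded_along w (x w) (fun k => y k w) (r / 2) r20 xAw.
  - move=> u [ux Au]; apply: rw; split => //; rewrite /eball/= in ux *.
    by rewrite (le_trans ux)//; lra.
  - by move=> k; split => //; exact: ydk.
  pose S := [set f k w | k in setT].
  have supS : has_sup S.
    split; first by exists (f 0%N w); exists 0%N.
    by exists B => _ [k _ <-]; rewrite -lee_fin fineK.
  have [_ [k _ <-] kS] := sup_adherent ltr01 supS.
  exists k => j _ /=.
  have : f j w <= sup S by apply: sup_upper_bound => //; exists j.
  by move: kS; lra.
have bdi : \forall w \ae P, enorm (y (i w) w - x w) <= r / 2.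
  by apply: filterS yd => w /ydk/(_ (i w)) /le_trans; apply.
have [] := @Linf_ex _ _ _ P n _ (`|x| + r / 2) myi.
  apply: filterS2 bdi (Linf_ae_le x) => w yxw xw.
  rewrite (_ : y (i w) w = x w + (y (i w) w - x w)); last by rewrite addrC subrK.
  by rewrite (le_trans (enormD _ _))// lerD.
move=> z zE.
have zfin : (Eint P h z < +oo)%E.
  apply: Dset_edom; apply: (Dset_radius_near rx).
    by apply: filterS2 zE yA => w -> yAw; exact: yAw.
  apply: Linf_norm_le; apply: filterS3 zE bdi (Linf_funB z x) => w zw + ->.
  by rewrite zw.
have [iz Ez] := Eint_lty_integrable (proj1 nh) Eint_neqNy zfin.
have icst : P.-integrable setT (cst 1%E : T -> \bar R).
  exact: finite_measure_integrable_cst.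
have ig := integrableD measurableT iz icst.
(* One finite integral bounds every [Eint P h (y k)], against the choice of [y k] with value above
   [k]. *)
have le_k k : (Eint P h (y k) <= \int[P]_w ((fun w => h (z w) w) \+ cst 1) w)%E.
  apply: (Eint_le (proj1 nh) Eint_neqNy ig).
  apply: filterS3 zE selZ yf => w -> /(_ k Logic.I) /= Zk yfw.
  by rewrite -(fineK (yfw k)) -(fineK (yfw (i w))) -EFinD lee_fin.
have /(integrable_fin_num measurableT)/fineK gE := ig.
set g := fine _ in gE.
have := Num.Theory.archi_boundP (normr_ge0 g); set N := Num.bound _ => gN.
have [_ _] := yP N; apply; apply: (le_trans (le_k N)).
by rewrite -gE lee_fin (le_trans (ler_norm _))// ltW.
Qed.

(** With the bound [M] at distance [delta], convexity is used twice for [y] within [t * delta]: [y]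
    lies between [x] and [x + (y - x)/t], which bounds the value at [y] from above, and [x] lies
    between [y] and [x - (y - x)/t], which bounds it from below. Both errors are at most
    [t (M - c)]. *)
Lemma Eint_continuous_ineq x (c : R) : Dset P h x -> Eint P h x = c%:E ->
  forall e : R, 0 < e -> exists2 delta, 0 < delta & forall y, Linf_sel P A y ->
    `|y - x| <= delta -> exists2 b : R, Eint P h y = b%:E & `|c - b| <= e.
Proof.
move=> Dx xc e e0; have [M [delta delta0 MP]] := Eint_locally_bounded Dx.
have cE := proj1 (convex_funP _) (Eint_convex (proj1 nh) Eint_neqNy (proj2 nh)).
have xA := Dset_affine Dx.
have cM : c <= M by rewrite -lee_fin -xc MP// subrr normr0 ltW.
pose K := M - c; have K0 : 0 <= K by rewrite subr_ge0.
(* This gives [t <= 1] and [t * K <= e], also when [K = 0]. *)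
pose t := e / (K + e); have Ke : 0 < K + e by rewrite ltr_wpDl.
have t0 : 0 < t by rewrite divr_gt0.
have t1 : t <= 1 by rewrite ler_pdivrMr// mul1r lerDr.
have tK : t * K <= e.
  by rewrite /t mulrAC ler_pdivrMr// ler_pM2l// lerDl ltW.
have aA : affine_set (Linf_sel P A).
  by apply: Linf_sel_affine => w; exact: affine_hull_affine.
exists (t * delta); first by rewrite mulr_gt0.
move=> y Ay yx.
have uM (s : R) : `|s| = t^-1 -> (Eint P h ((1 - s) *: x + s *: y)%R <= M%:E)%E.
  move=> st; apply: MP; first exact: aA.
  by rewrite affine_comb_subl normrZ st mulrC ler_pdivrMr// mulrC.
have u1 : (Eint P h ((1 - t^-1) *: x + t^-1 *: y)%R <= M%:E)%E.
  by apply: uM; rewrite gtr0_norm ?invr_gt0.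
have u2 : (Eint P h ((1 - - t^-1) *: x + - t^-1 *: y)%R <= M%:E)%E.
  by apply: uM; rewrite normrN gtr0_norm ?invr_gt0.
have xle : (Eint P h x <= c%:E)%E by rewrite xc.
have t01 : 0 <= t <= 1 by rewrite ltW.
have yle := cE _ _ _ _ _ t01 u1 xle.
have yE : t *: ((1 - t^-1) *: x + t^-1 *: y) + (1 - t) *: x = y.
  rewrite scalerDr !scalerA mulfV ?gt_eqF// scale1r addrAC -scalerDl.
  rewrite (_ : t * (1 - t^-1) + (1 - t) = 0) ?scale0r ?add0r//.
  by field; rewrite gt_eqF.
rewrite yE in yle.
have yfin : Eint P h y \is a fin_num.
  by rewrite fin_numE Eint_neqNy/= -ltey (le_lt_trans yle)// ltry.
exists (fine (Eint P h y)); first by rewrite fineK.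
set b := fine _; have yb : Eint P h y = b%:E by rewrite fineK.
have t10 : 0 < 1 + t by rewrite addr_gt0.
have s01 : 0 <= (1 + t)^-1 <= 1.
  by rewrite invr_ge0 (ltW t10)/= invf_le1// lerDl ltW.
have yleb : (Eint P h y <= b%:E)%E by rewrite yb.
have := cE _ _ _ _ _ s01 yleb u2.
have -> : (1 + t)^-1 *: y + (1 - (1 + t)^-1) *: ((1 - - t^-1) *: x + - t^-1 *: y) = x.
  rewrite scalerDr !scalerA addrCA -scalerDl.
  rewrite (_ : (1 + t)^-1 + (1 - (1 + t)^-1) * - t^-1 = 0); last by field; rewrite !gt_eqF.
  rewrite (_ : (1 - (1 + t)^-1) * (1 - - t^-1) = 1); last by field; rewrite !gt_eqF.
  by rewrite scale1r scale0r addr0.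
rewrite xc lee_fin => cle.
move: yle; rewrite yb lee_fin => ble.
have cle' : (1 + t) * c <= b + t * M.
  have := ler_wpM2l (ltW t10) cle; congr (_ <= _).
  by field; rewrite gt_eqF.
by rewrite ler_norml; apply/andP; split; move: tK; rewrite /K; nra.
Qed.

Lemma Eint_continuous x : Dset P h x ->
  Eint P h y @[y --> within (affine_hull (edom (Eint P h))) (nbhs x)]
      --> Eint P h x.
Proof.
move=> Dx; rewrite affine_hull_edom_Eint//; last by exists x.
have xfin : Eint P h x \is a fin_num.
  by rewrite fin_numE Eint_neqNy/= -ltey Dset_edom.
have key := @Eint_continuous_ineq x _ Dx (esym (fineK xfin)).
rewrite -(fineK xfin); apply/fine_cvgP; split.
  have [delta delta0 dP] := key 1 ltr01.
  apply/nbhs_ballP; exists delta => //= y; rewrite -ball_normE/= distrC => yx Ay.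
  by have [b -> _] := dP y Ay (ltW yx).
apply/cvgrPdist_le => /= e e0; have [delta delta0 dP] := key e e0.
apply/nbhs_ballP; exists delta => //= y; rewrite -ball_normE/= distrC => yx Ay.
by have [b -> bc] := dP y Ay (ltW yx).
Qed.

End continuity.

(** * Minimization over an epigraph: projections, subgradients and Moreau envelopes *)

Section epigraph_minimization.
Context {R : realType} {n : nat}.
Implicit Types (f : 'rV[R]_n -> \bar R) (x z q v eta xi : 'rV[R]_n).
Local Notation VR := ('rV[R]_n * R^o)%type.

Lemma ler_sqr_bound (a s : R) : a ^+ 2 <= s -> `|a| <= s + 1.
Proof.
move=> as_; rewrite ler_norml; have := sqr_ge0 (a - 1); have := sqr_ge0 (a + 1).
rewrite !expr2 in as_ * => h1 h2; apply/andP; split; nra.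
Qed.

Lemma enorm_le_dotv x (s : R) : dotv x x <= s -> enorm x <= s + 1.
Proof. by rewrite -enorm_sqr => /ler_sqr_bound; rewrite ger0_norm ?enorm_ge0. Qed.

Lemma lee_forall_epi (g : R) (e : \bar R) :
  (forall b : R, (e <= b%:E)%E -> g <= b) -> (g%:E <= e)%E.
Proof.
case: e => [r| |] H; rewrite ?leey ?lee_fin//; first exact: H.
by have gg : g <= g - 1 by [apply: H; rewrite leNye]; exfalso; lra.
Qed.

Lemma epi_closed_le f x (c : R) : closed (epi f) ->
  (forall e : R, 0 < e -> exists y : VR,
     [/\ epi f y, enorm (y.1 - x) < e & `|(y.2 : R) - c| < e]) ->
  (f x <= c%:E)%E.
Proof.
move=> clf H; suff : epi f (x, c) by [].
apply: clf => B /nbhs_ballP[e /= e0 eB].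
have [y [fy y1 y2]] := H e e0; exists y; split => //; apply: eB; split => /=.
  split => // i j; rewrite ord1 /ball/= distrC.
  have := coord_le_enorm (y.1 - x) j; rewrite !mxE => /le_lt_trans; exact.
by rewrite /ball/= distrC.
Qed.

(** The variational inequality says that [(q - eta, - (k * a + m))] is normal to the epigraph at
    [(eta, a)]; dividing by [k * a + m > 0] turns it into a subgradient. *)
Lemma qvi_subgradient f (k m a : R) q eta : epi f (eta, a) ->
  (forall y, epi f y -> 0 <= qvi k q m (eta, a) y) -> 0 < k * a + m ->
  f eta = a%:E /\
  forall xi, ((a + (k * a + m)^-1 * dotv (q - eta) (xi - eta))%:E <= f xi)%E.
Proof.
move=> fea vi t0; set t := k * a + m in t0 *.
have sub xi : ((a + t^-1 * dotv (q - eta) (xi - eta))%:E <= f xi)%E.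
  apply: lee_forall_epi => b fb.
  have := vi (xi, b) fb; rewrite /qvi/= -/t -[eta - q]opprB dotvNl.
  rewrite addrC subr_ge0 [t * _]mulrC -ler_pdivrMr// lerBrDl.
  by rewrite [_ / t]mulrC.
split => //; apply/le_anti/andP; split; first exact: fea.
by have := sub eta; rewrite subrr dotvC (_ : dotv 0 _ = 0) ?mulr0 ?addr0//
  -(scale0r 0) dotvZl mul0r.
Qed.

(** After adding [m ^+ 2] the objective is the squared distance to [(x, - m)], so its sublevel sets
    are bounded. *)
Lemma projection_min_exists f x (c m : R) : closed (epi f) -> (f x <= c%:E)%E ->
  exists2 p, epi f p & forall y, epi f y -> qobj 1 x m p <= qobj 1 x m y.
Proof.
move=> clf fx; pose s := qobj 1 x m (x, c) + m ^+ 2.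
apply: (@qobj_min_exists _ _ _ _ _ _ (x, c) (enorm x + `|m| + (s + 1))) => // y _.
rewrite -(lerD2r (m ^+ 2)) -/s => ys.
have sq : dotv (y.1 - x) (y.1 - x) + ((y.2 : R) + m) ^+ 2 <= s.
  by move: ys; rewrite {1}/qobj mul1r; congr (_ <= _); ring.
have d0 := dotvv_ge0 (y.1 - x); have m0 := sqr_ge0 ((y.2 : R) + m).
split.
  rewrite -[y.1](subrK x) (le_trans (enormD _ _))//.
  have : enorm (y.1 - x) <= s + 1 by apply: enorm_le_dotv; lra.
  by have := normr_ge0 m; lra.
rewrite -[y.2 : R](addrK m) (le_trans (ler_normB _ _))//.
have : `|(y.2 : R) + m| <= s + 1 by apply: ler_sqr_bound; lra.
by have := enorm_ge0 x; lra.
Qed.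

(** Testing the inequality at [(x, c)] gives [|x - eta|^2 <= t (1 - t)], hence [t >= 0]. Moving the
    base point of the subgradient from [eta] to [x] gains [t^-1 |x - eta|^2], and [a] exceeds
    [c - 1] by [t]. *)
Lemma projection_subgradient f x (c a : R) eta : f x = c%:E -> epi f (eta, a) ->
  (forall y, epi f y -> 0 <= qvi 1 x (1 - c) (eta, a) y) ->
  [/\ 0 < a + (1 - c), f eta = a%:E & forall xi,
    ((c - 1 + dotv ((a + (1 - c))^-1 *: (x - eta)) (xi - x))%:E <= f xi)%E].
Proof.
move=> fx fea vi; pose t := a + (1 - c).
have := vi (x, c); rewrite /epi/= fx lexx => /(_ isT).
rewrite /qvi/= mul1r -/t -[eta - x]opprB dotvNl.
rewrite (_ : c - a = 1 - t) => [vix|]; last by rewrite /t; ring.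
have s0 := dotvv_ge0 (x - eta).
have t0 : 0 < t.
  (* In the remaining case [t_neq0] is the equation [t = 0]: then [eta = x], and [a = c - 1] would
     be below [f x]. *)
  have [t_neq0|t_eq0] := eqVneq t 0; last by nra.
  have /enorm_eq0 /eqP : enorm (x - eta) = 0.
    apply/eqP; rewrite -sqrf_eq0 enorm_sqr; apply/eqP; move: vix; rewrite t_neq0; lra.
  rewrite subr_eq0 => /eqP xe; move: fea; rewrite /epi/= -xe fx lee_fin.
  by move: t_neq0; rewrite /t; lra.
have t1 : 0 < 1 * a + (1 - c) by rewrite mul1r.
have [fe sub] := qvi_subgradient fea vi t1.
split => // xi; apply: le_trans (sub xi); rewrite lee_fin mul1r -/t dotvZl.
rewrite -[xi - eta](subrKA x) (dotvDr _ (xi - x)) mulrDr.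
have : 0 <= t^-1 * dotv (x - eta) (x - eta) by rewrite mulr_ge0// invr_ge0 ltW.
by move: t0; rewrite /t; lra.
Qed.

(** Up to a constant this is [2 l] times the objective of the Moreau envelope of [f - v + b] at [z].
    If [dotv v xi - b] minorizes [f], the middle term is nonnegative on the epigraph, which yields
    the bounds in [moreau_min_exists]. *)
Lemma qobj_tilt z v (l b : R) (y : VR) :
  qobj 0 (z + l *: v) l y = dotv (y.1 - z) (y.1 - z) +
    2 * l * ((y.2 : R) - dotv v y.1 + b) +
    (2 * l * dotv v z + l ^+ 2 * dotv v v - 2 * l * b).
Proof.
by rewrite qobj_shift /qobj mul0r addr0 (dotvBr v); ring.
Qed.

Lemma moreau_min_exists f z v x (l b c : R) : closed (epi f) -> 0 < l ->
  (f x <= c%:E)%E -> (forall xi, ((dotv v xi - b)%:E <= f xi)%E) ->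
  exists2 p, epi f p & forall y, epi f y ->
    qobj 0 (z + l *: v) l p <= qobj 0 (z + l *: v) l y.
Proof.
move=> clf l0 fx fge.
pose s := dotv (x - z) (x - z) + 2 * l * (c - dotv v x + b).
pose B := enorm z + (s + 1).
apply: (@qobj_min_exists _ _ _ _ _ _ (x, c)
  (B + (enorm v * B + `|b| + s / (2 * l)))) => // y fy.
rewrite !(qobj_tilt _ _ _ b) lerD2r -/s/= => ys.
have y2 : 0 <= (y.2 : R) - dotv v y.1 + b.
  have := le_trans (fge y.1) fy; rewrite lee_fin; lra.
have d0 := dotvv_ge0 (y.1 - z).
have l20 : 0 < 2 * l by rewrite mulr_gt0.
have p0 : 0 <= 2 * l * ((y.2 : R) - dotv v y.1 + b) by rewrite mulr_ge0// ltW.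
have yB : enorm y.1 <= B.
  rewrite -[y.1](subrK z) (le_trans (enormD _ _))// /B addrC lerD2l.
  by apply: enorm_le_dotv; lra.
have B0 : 0 <= B by exact: le_trans (enorm_ge0 _) yB.
have s0 : 0 <= s by lra.
have sl : 0 <= s / (2 * l) by rewrite divr_ge0// ltW.
have vB : 0 <= enorm v * B by rewrite mulr_ge0 ?enorm_ge0.
split; first by have := normr_ge0 b; lra.
have yl : (y.2 : R) - dotv v y.1 + b <= s / (2 * l).
  by rewrite ler_pdivlMr// mulrC; lra.
have : `|dotv v y.1| <= enorm v * B.
  by rewrite (le_trans (dotv_norm_le _ _))// ler_wpM2l ?enorm_ge0.
rewrite !ler_norml => /andP[v1 v2]; have b1 := ler_norm b.
have b2 := ler_norm (- b); rewrite normrN in b2.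
by apply/andP; split; lra.
Qed.

End epigraph_minimization.

Section vector_measurability.
Context {d : measure_display} {T : measurableType d} {R : realType} {n : nat}.
Implicit Types (f g : T -> 'rV[R]_n) (s : T -> R).

Lemma mfunvD f g : mfunv f -> mfunv g -> mfunv (fun w => f w + g w).
Proof.
move=> mf mg j; rewrite (_ : (fun _ => _) = (fun w => f w 0 j + g w 0 j)).
  exact: measurable_funD.
by apply/funext => w; rewrite mxE.
Qed.

Lemma mfunvZ s f : measurable_fun setT s -> mfunv f -> mfunv (fun w => s w *: f w).
Proof.
move=> ms mf j; rewrite (_ : (fun _ => _) = (fun w => s w * f w 0 j)).
  exact: measurable_funM.
by apply/funext => w; rewrite mxE.
Qed.

Lemma mfunvB f g : mfunv f -> mfunv g -> mfunv (fun w => f w - g w).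
Proof.
move=> mf mg j; rewrite (_ : (fun _ => _) = (fun w => f w 0 j - g w 0 j)).
  exact: measurable_funB.
by apply/funext => w; rewrite !mxE.
Qed.

End vector_measurability.

(** * Bounds on the biconjugate *)

Section conjugates.
Context {d : measure_display} {T : measurableType d} {R : realType}.
Context {P : probability T R} {n : nat}.
Implicit Types (f : Linf P n -> \bar R) (z : Linf P n) (v : Lone P n).

Lemma biconjugate_le f z : f z != -oo%E -> (biconjugate f z <= f z)%E.
Proof.
move=> fz; apply: ge_ereal_sup => _ [v _ <-].
have : ((pairing z v)%:E - f z <= conjugate f v)%E.
  by apply: ereal_sup_ubound; exists z.
case: (f z) fz => [r| |]//= _; last by rewrite leey.
case: (conjugate f v) => [c| |]//=; rewrite -?EFinB ?lee_fin ?leNye//; lra.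
Qed.

(** An affine minorant with slope [v] and value [b] at [z] bounds the conjugate at [v] by
    [pairing z v - b]. *)
Lemma biconjugate_ge f z v (b : R) :
  (forall y, ((b + (pairing y v - pairing z v))%:E <= f y)%E) ->
  (b%:E <= biconjugate f z)%E.
Proof.
move=> H; apply: (@le_trans _ _ ((pairing z v)%:E - conjugate f v)%E); last first.
  by apply: ereal_sup_ubound; exists v.
have : (conjugate f v <= (pairing z v - b)%:E)%E.
  apply: ge_ereal_sup => _ [y _ <-]; have := H y.
  case: (f y) => [r| |]//=; rewrite -?EFinB ?lee_fin ?leNye//; lra.
have : ((pairing z v)%:E - f z <= conjugate f v)%E.
  by apply: ereal_sup_ubound; exists z.
case: (conjugate f v) => [c| |]//=; rewrite -?EFinB ?lee_fin ?leey//; lra.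
Qed.

End conjugates.

(** * An integrable approximate subgradient at a point of D *)

Section closedness.
Context {d : measure_display} {T : measurableType d} {R : realType}.
Context {P : probability T R} {n : nat} {h : 'rV[R]_n -> T -> \bar R}.
Hypothesis nh : convex_normal_integrand h.
Hypothesis Eint_neqNy : forall x : Linf P n, Eint P h x != -oo%E.
Hypothesis Dset_edom : Dset P h `<=` edom (Eint P h).
Implicit Types x y z : Linf P n.

Let hfin x : set T := [set w | h (x w) w \is a fin_num].

Lemma measurable_hfin x : measurable (hfin x).
Proof.
have := emeasurable_fin_num measurableT (measurable_integrand (proj1 nh) x).
by rewrite setTI.
Qed.

Lemma measurable_fine_integrand (q : T -> 'rV[R]_n) : mfunv q ->
  measurable_fun setT (fun w => fine (h (q w) w)).
Proof.
move=> mq; apply: measurableT_comp => //.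
exact: measurable_fun_normal_integrand (proj1 nh) _.
Qed.

(* The 1-subgradient v0(w) at x0(w) is the slope of the hyperplane separating
   (x0(w), h(x0(w)) - 1) from the epigraph; it is integrable because
   x0 + (r/2) v0/|v0| belongs to D. *)
Lemma integrable_subgradient x0 : Dset P h x0 -> exists v0 : T -> 'rV[R]_n,
  [/\ mfunv v0, P.-integrable setT (EFin \o (enorm \o v0)) &
  forall w, hfin x0 w -> forall xi,
    ((fine (h (x0 w) w) - 1 + dotv (v0 w) (xi - x0 w))%:E <= h xi w)%E].
Proof.
move=> Dx0; have [r rx0] := proj1 (Dset_radiusP x0) Dx0.
have [r0 _] := rx0; have r20 : 0 < r / 2 by rewrite divr_gt0.
pose f0 w := fine (h (x0 w) w); have mx0 : mfunv x0 := mfunv_Lp x0.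
have mf0 : measurable_fun setT f0 by exact: measurable_fine_integrand.
have m1 : measurable_fun setT (fun w => 1 - f0 w) by exact: measurable_funB.
have [] := @measurable_argmin _ _ R n (fun w => epi (h ^~ w)) 1 x0
  (fun w => 1 - f0 w) (hfin x0) ler01 (proj2 (proj1 nh)) (proj2 nh)
  (measurable_hfin x0) mx0 m1.
  move=> w xw; apply: (@projection_min_exists _ _ _ _ (f0 w)).
    exact: (proj1 (proj1 nh)).
  by rewrite /f0 fineK.
move=> eta meta etaP.
pose tau w := fine (h (eta w) w) + (1 - f0 w).
have mtau : measurable_fun setT tau.
  by apply: measurable_funD => //; exact: measurable_fine_integrand.
pose v0 w := (tau w `^ (-1)) *: (x0 w - eta w).
have mv0 : mfunv v0.
  apply: mfunvZ; last exact: mfunvB.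
  exact: (@measurableT_comp _ _ _ _ _ _ (@powR R ^~ (-1))).
have v0P w : hfin x0 w -> [/\ 0 < tau w, edom (h ^~ w) (eta w) &
    forall xi, ((f0 w - 1 + dotv (v0 w) (xi - x0 w))%:E <= h xi w)%E].
  move=> xw; have [a ea vi] := etaP w xw.
  have [t0 he sub] := projection_subgradient (esym (fineK xw)) ea vi.
  have tE : tau w = a + (1 - f0 w) by rewrite /tau he.
  rewrite /v0 tE powR_inv1 ?(ltW t0)//; split => //.
  by rewrite /edom/= he ltry.
have x0fin : \forall w \ae P, hfin x0 w.
  exact: (Eint_fin (proj1 nh) Eint_neqNy (Dset_edom Dx0)).
exists v0; split => //; last by move=> w /v0P[].
(* The direction of [v0 w] with length [r / 2], equal to 0 where [v0 w = 0]; its product with [v0 w]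
   is [r / 2] times the norm of [v0 w]. *)
pose u w := (r / 2 * (enorm (v0 w)) `^ (-1)) *: v0 w.
have mu : mfunv u.
  apply: mfunvZ => //; apply: measurable_funM => //.
  apply: (@measurableT_comp _ _ _ _ _ _ (@powR R ^~ (-1))) => //.
  exact: mfunv_enorm.
have v0u w : dotv (v0 w) (u w) = r / 2 * enorm (v0 w).
  rewrite /u dotvZr powR_inv1 ?enorm_ge0// -enorm_sqr -mulrA; congr (_ * _).
  have [->|v0w] := eqVneq (enorm (v0 w)) 0; first by rewrite expr0n/= mulr0.
  by rewrite expr2 mulKf.
have un w : enorm (u w) <= r / 2.
  rewrite /u enormZ powR_inv1 ?enorm_ge0// ger0_norm; last first.
    by rewrite mulr_ge0 ?invr_ge0 ?enorm_ge0// ltW.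
  have [->|v0w] := eqVneq (enorm (v0 w)) 0; first by rewrite mulr0 ltW.
  by rewrite divfK.
have [] := @Linf_ex _ _ _ P n (fun w => x0 w + u w) (`|x0| + r / 2) (mfunvD mx0 mu).
  apply: filterS (Linf_ae_le x0) => w xw; rewrite (le_trans (enormD _ _))//.
  exact: lerD.
move=> y yE.
have yfin : (Eint P h y < +oo)%E.
  apply: Dset_edom; apply: (Dset_radius_near rx0).
    apply: filterS3 yE x0fin (Dset_affine Dx0) => w -> /v0P[_ etaA _] xA.
    rewrite /u /v0 !scalerA; apply: (@affine_setD _ _ (affine_hull _)) => //.
      exact: affine_hull_affine.
    exact: sub_affine_hull.
  apply: Linf_norm_le; apply: filterS2 yE (Linf_funB y x0) => w yw ->.
  by rewrite yw [x0 w + _]addrC addrK.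
have [iy _] := Eint_lty_integrable (proj1 nh) Eint_neqNy yfin.
have [ix _] := Eint_lty_integrable (proj1 nh) Eint_neqNy (Dset_edom Dx0).
have i1 : P.-integrable setT (cst 1%E : T -> \bar R).
  exact: finite_measure_integrable_cst.
(* The subgradient inequality at [y = x0 + u] bounds [r / 2] times the norm of [v0] by
   [h(y) - h(x0) + 1]. *)
have ig := integrableZl measurableT (r / 2)^-1
  (integrableD measurableT (integrableB measurableT iy ix) i1).
apply: ae_le_integrable ig; first exact/measurable_EFinP/mfunv_enorm.
have yf := Eint_fin (proj1 nh) Eint_neqNy yfin.
apply: filterS3 yE x0fin yf => w yw xw yfw /=.
have [_ _ /(_ (y w))] := v0P w xw; rewrite yw [x0 w + _ - _]addrC addKr v0u -yw.
rewrite -(fineK yfw) -[h (x0 w) w](fineK xw) -/(f0 w).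
rewrite -EFinB -EFinD -EFinM lee_fin /= lee_fin => le1.
rewrite ger0_norm ?enorm_ge0// (le_trans _ (ler_norm _))//.
by rewrite ler_pdivlMl//; lra.
Qed.

End closedness.

(** Identifies the integrand of the affine minorant in [moreau_minorant], with slope
    [l^-1 (z - eta) + v], with the subgradient bound from [moreau_point]. *)
Lemma moreau_identity {R : realType} {n : nat} (y z eta v : 'rV[R]_n) (a b l : R) :
  l != 0 ->
  a - dotv v eta + b + l^-1 * dotv (eta - z) (eta - z) + (dotv z v - b) +
  (dotv y (l^-1 *: (z - eta) + v) - dotv z (l^-1 *: (z - eta) + v)) =
  a + l^-1 * dotv (z + l *: v - eta) (y - eta).
Proof.
move=> l0; rewrite !(dotvDl, dotvDr, dotvZl, dotvZr, dotvNl, dotvNr).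
rewrite !(dotvC eta z) ?(dotvC eta y) ?(dotvC z y) ?(dotvC v y) ?(dotvC v eta).
by rewrite ?(dotvC v z); field.
Qed.

(** * Integrable affine minorants from Moreau envelopes, and the passage to the limit *)

Section moreau_envelope.
Context {d : measure_display} {T : measurableType d} {R : realType}.
Context {P : probability T R} {n : nat} {h : 'rV[R]_n -> T -> \bar R}.
Hypothesis nh : convex_normal_integrand h.
Hypothesis Eint_neqNy : forall x : Linf P n, Eint P h x != -oo%E.
Hypothesis Dset_edom : Dset P h `<=` edom (Eint P h).
Implicit Types x y z : Linf P n.

Let hfin x : set T := [set w | h (x w) w \is a fin_num].
Variables (x0 : Linf P n) (v0 : T -> 'rV[R]_n).
Hypothesis x0dom : (Eint P h x0 < +oo)%E.
Hypothesis mv0 : mfunv v0.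
Hypothesis iv0 : P.-integrable setT (EFin \o (enorm \o v0)).
Hypothesis v0P : forall w, hfin x0 w -> forall xi,
  ((fine (h (x0 w) w) - 1 + dotv (v0 w) (xi - x0 w))%:E <= h xi w)%E.

Let b0 w := dotv (v0 w) (x0 w) - fine (h (x0 w) w) + 1.

Let x0fin : \forall w \ae P, hfin x0 w.
Proof. exact: (Eint_fin (proj1 nh) Eint_neqNy x0dom). Qed.

Let v0b0 w : hfin x0 w -> forall xi, ((dotv (v0 w) xi - b0 w)%:E <= h xi w)%E.
Proof.
move=> xw xi; have := v0P xw xi; rewrite dotvBr /b0; congr (_ <= _)%E.
by congr (_%:E); ring.
Qed.

Let mb0 : measurable_fun setT b0.
Proof.
apply: measurable_funD => //; apply: measurable_funB.
  by apply: measurable_dotv => //; exact: mfunv_Lp.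
by apply: (measurable_fine_integrand nh); exact: mfunv_Lp.
Qed.

Let ib0 : P.-integrable setT (EFin \o b0).
Proof.
have [ix _] := Eint_lty_integrable (proj1 nh) Eint_neqNy x0dom.
have i1 : P.-integrable setT (cst 1%E : T -> \bar R).
  exact: finite_measure_integrable_cst.
have id : P.-integrable setT (fun w => (dotv (x0 w) (v0 w))%:E).
  apply: (integrable_dotv (M := `|x0|)) => //; first exact: mfunv_Lp.
  exact: Linf_ae_le.
apply: ae_le_integrable (integrableD measurableT (integrableB measurableT id ix) i1).
  exact/measurable_EFinP.
apply: filterS x0fin => w xw /=; rewrite -[h _ _](fineK xw) -EFinB -EFinD.
by rewrite /b0 dotvC.
Qed.

(** The last estimate compares the minimizer with the competitor [x0 w], where [h - v0 + b0] equals
    1 by the choice of [b0]. *)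
Lemma moreau_point z (l : R) : 0 < l ->
  exists2 eta : T -> 'rV[R]_n, mfunv eta & forall w, hfin x0 w ->
    let a := fine (h (eta w) w) in
    [/\ h (eta w) w = a%:E, forall xi, ((a + l^-1 *
         dotv (z w + l *: v0 w - eta w) (xi - eta w))%:E <= h xi w)%E &
    dotv (eta w - z w) (eta w - z w) + 2 * l * (a - dotv (v0 w) (eta w) + b0 w)
      <= dotv (x0 w - z w) (x0 w - z w) + 2 * l].
Proof.
move=> l0; pose q w := z w + l *: v0 w.
have mz : mfunv z := mfunv_Lp z.
have mq : mfunv q by apply: mfunvD => //; exact: (mfunvZ (measurable_cst l)).
have [] := @measurable_argmin _ _ R n (fun w => epi (h ^~ w)) 0 q
  (cst l) (hfin x0) (lexx _) (proj2 (proj1 nh)) (proj2 nh)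
  (measurable_hfin nh x0) mq (measurable_cst l).
  move=> w xw; apply: (@moreau_min_exists _ _ _ _ _ (x0 w) _ (b0 w)
    (fine (h (x0 w) w))) => //; first exact: (proj1 (proj1 nh)).
    by rewrite fineK.
  exact: v0b0.
move=> eta meta etaP; exists eta => // w xw a0; have [a ea vi] := etaP w xw.
have t0 : 0 < 0 * (a : R) + cst l w by rewrite mul0r add0r.
have [he sub] := qvi_subgradient ea vi t0.
have aE : a0 = a by rewrite /a0 he.
rewrite aE; split => // [xi|].
  by have := sub xi; rewrite mul0r add0r.
have x0epi : epi (h ^~ w) (x0 w, fine (h (x0 w) w)) by rewrite /epi/= fineK.
have := qvi_qobj_ge (lexx 0) (vi _ x0epi); rewrite /cst.
rewrite !(qobj_tilt _ _ _ (b0 w)) /= => ge.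
have d0 := dotvv_ge0 (x0 w - eta w).
have b0E : fine (h (x0 w) w) - dotv (v0 w) (x0 w) + b0 w = 1 by rewrite /b0; ring.
by rewrite b0E in ge; lra.
Qed.

(** [e w] is the value at [z w] of the affine function that supports [h - v0 + b0] at the minimizer
    [eta]. Its slope [l^-1 (z - eta)] is bounded, so adding [v0] gives an L^1 slope and hence an
    affine minorant of [Eint P h]. *)
Lemma moreau_minorant z (l : R) : 0 < l -> exists e : T -> R,
  [/\ P.-integrable setT (EFin \o e),
  (forall w, hfin x0 w -> 0 <= e w /\ exists eta,
    dotv (eta - z w) (eta - z w) <= l * e w /\
    (h eta w <= (e w + dotv (v0 w) eta - b0 w)%:E)%E) &
  (\int[P]_w (e w + (dotv (z w) (v0 w) - b0 w))%:E
    <= biconjugate (Eint P h) z)%E].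
Proof.
move=> l0; have [eta meta etaP] := moreau_point z l0.
have mz : mfunv z := mfunv_Lp z.
pose a w := fine (h (eta w) w).
pose D w := dotv (eta w - z w) (eta w - z w).
have mD : measurable_fun setT D by apply: measurable_dotv; exact: mfunvB.
pose g w := a w - dotv (v0 w) (eta w) + b0 w.
have mg : measurable_fun setT g.
  apply: measurable_funD => //; apply: measurable_funB.
    exact: measurable_fine_integrand.
  exact: measurable_dotv.
pose e w := g w + l^-1 * D w.
have me : measurable_fun setT e.
  by apply: measurable_funD => //; exact: measurable_funM.
have l1 : 0 < l^-1 by rewrite invr_gt0.
have D0 w : 0 <= D w := dotvv_ge0 _.
have g0 w : hfin x0 w -> 0 <= g w.
  move=> xw; have [he _ _] := etaP w xw.
  have := v0b0 xw (eta w); rewrite he lee_fin /g /a; lra.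
have gD w : hfin x0 w ->
    D w + 2 * l * g w <= dotv (x0 w - z w) (x0 w - z w) + 2 * l.
  by move=> /etaP[].
(* A single constant bounds both parts of [e], because [x0 - z] is essentially bounded. *)
pose K := `|x0 - z| ^+ 2 + 2 * l.
have dK : \forall w \ae P, D w <= K /\ 2 * l * g w <= K.
  apply: filterS2 x0fin (Linf_dist_ae_le x0 z) => w xw dw.
  have := gD w xw; have := g0 w xw; have := D0 w.
  have : dotv (x0 w - z w) (x0 w - z w) <= `|x0 - z| ^+ 2.
    by rewrite -enorm_sqr ler_sqr ?nnegrE ?enorm_ge0.
  by rewrite /K; move=> *; split; nra.
have ie : P.-integrable setT (EFin \o e).
  apply: (@integrable_bounded _ _ _ _ _ (K / (2 * l) + l^-1 * K)) => //.
  apply: filterS2 x0fin dK => w xw [DK gK].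
  rewrite ger0_norm; last by rewrite addr_ge0 ?g0// mulr_ge0// ltW.
  rewrite lerD//; last by rewrite ler_pM2l.
  by rewrite ler_pdivlMr ?mulr_gt0// mulrC.
exists e; split => // [w xw|].
  split; first by rewrite addr_ge0 ?g0// mulr_ge0// ltW.
  exists (eta w); split.
    rewrite -/(D w) mulrDr mulrA mulfV ?gt_eqF// mul1r lerDr mulr_ge0 ?g0//.
    exact: ltW.
  have [-> _ _] := etaP w xw; rewrite lee_fin -/(a w) /e /g.
  by have := mulr_ge0 (ltW l1) (D0 w); lra.
pose v w := l^-1 *: (z w - eta w) + v0 w.
have mv : mfunv v.
  by apply: mfunvD => //; apply: mfunvZ => //; exact: mfunvB.
have iv : P.-integrable setT (EFin \o (enorm \o v)).
  have iK : P.-integrable setT (cst (l^-1 * (K + 1))%:E : T -> \bar R).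
    exact: finite_measure_integrable_cst.
  apply: ae_le_integrable (integrableD measurableT iK iv0).
    exact/measurable_EFinP/mfunv_enorm.
  apply: filterS dK => w [DK _] /=; rewrite lee_fin ger0_norm ?enorm_ge0//.
  rewrite (le_trans _ (ler_norm _))// (le_trans (enormD _ _))// lerD2r.
  rewrite enormZ gtr0_norm// ler_pM2l// enormB.
  exact: enorm_le_dotv.
have [vv vvE] := Lone_ex mv iv.
pose ll w := e w + (dotv (z w) (v0 w) - b0 w).
have iz (y : Linf P n) : P.-integrable setT (fun w => (dotv (y w) (vv w))%:E).
  apply: (integrable_dotv (M := `|y|)); [exact: mfunv_Lp..|exact: Linf_ae_le|].
  exact: Lone_integrable.
have izv0 : P.-integrable setT (fun w => (dotv (z w) (v0 w))%:E).
  by apply: (integrable_dotv (M := `|z|)) => //; exact: Linf_ae_le.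
have ill : P.-integrable setT (EFin \o ll).
  exact: (integrableD measurableT ie (integrableB measurableT izv0 ib0)).
have /fineK llE := integrable_fin_num measurableT ill.
rewrite -/(ll _) -[X in (X <= _)%E]llE.
apply: (@biconjugate_ge _ _ _ _ _ _ _ vv) => y.
rewrite EFinD EFinB llE !pairingE -integralB//.
have iyz := integrableB measurableT (iz y) (iz z).
rewrite -(integralD measurableT ill iyz).
apply: (Eint_ge (proj1 nh) Eint_neqNy); first exact: integrableD.
apply: filterS2 x0fin vvE => w xw vvw; rewrite vvw /= -EFinB -EFinD.
have [_ /(_ (y w)) + _] := etaP w xw; apply: le_trans; rewrite lee_fin -/(a w).
by rewrite /ll /e /g /D /v moreau_identity ?gt_eqF.
Qed.

(** Let [l = 1/(k+1)] tend to 0. Fatou's lemma bounds the integral of the lower limit [G] of the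
    [e k]. Wherever [G] is finite, [e k] stays bounded along a subsequence, which forces the
    minimizers to tend to [z w], and closedness of the epigraph gives [h (z w) w <= G w + c w]. *)
Lemma Eint_le_biconjugate z : (Eint P h z <= biconjugate (Eint P h) z)%E.
Proof.
have [->|bicy] := eqVneq (biconjugate (Eint P h) z) +oo%E; first by rewrite leey.
have lam0 k : 0 < k.+1%:R^-1 :> R by [].
have /choice[e eP] := fun k => moreau_minorant z (lam0 k).
pose c w := dotv (z w) (v0 w) - b0 w.
have ic : P.-integrable setT (EFin \o c).
  have izv0 : P.-integrable setT (fun w => (dotv (z w) (v0 w))%:E).
    apply: (integrable_dotv (M := `|z|)) => //; first exact: mfunv_Lp.
    exact: Linf_ae_le.
  exact: (integrableB measurableT izv0 ib0).
have ie k : P.-integrable setT (EFin \o e k) by case: (eP k).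
have me k : measurable_fun setT (e k).
  by have /integrableP[/measurable_EFinP] := ie k.
have cfin := integrable_fin_num measurableT ic.
have ebic k :
    (\int[P]_w (e k w)%:E + \int[P]_w (c w)%:E <= biconjugate (Eint P h) z)%E.
  by rewrite -(integralD measurableT (ie k) ic); case: (eP k).
have bicfin : biconjugate (Eint P h) z \is a fin_num.
  rewrite fin_numE bicy andbT -ltNye (lt_le_trans _ (ebic 0%N))//.
  by rewrite -(integralD measurableT (ie 0%N) ic) ltNye_eq integrable_fin_num//;
    exact: integrableD.
(* Truncation at 0 changes [e k] only on a null set and gives the nonnegativity at every point
   required by Fatou's lemma. *)
pose E k w : \bar R := (Num.max (e k w) 0)%:E.
have E0 k w : (0 <= E k w)%E by rewrite lee_fin le_max lexx orbT.
have mE k : measurable_fun setT (E k).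
  by apply/measurable_EFinP; exact: measurable_maxr.
have EC k : (\int[P]_w E k w <= biconjugate (Eint P h) z - \int[P]_w (c w)%:E)%E.
  rewrite leeBrDr// (le_trans _ (ebic k))// leeD2r//.
  rewrite (ae_eq_integral (EFin \o e k))//; first exact/measurable_EFinP.
  apply: filterS x0fin => w xw _; rewrite /E /= max_l//.
  by have [_ /(_ w xw)[]] := eP k.
pose G w := limn_einf (E ^~ w).
have GE w : G w = ereal_sup (range (einfs (E ^~ w))).
  by rewrite /G limn_einf_lim; apply/cvg_lim => //; exact: cvg_einfs_sup.
have einfs0 w k : (0 <= einfs (E ^~ w) k)%E.
  by apply: le_ereal_inf_tmp => _ [j /= _ <-].
have einfsG w k : (einfs (E ^~ w) k <= G w)%E.
  by rewrite GE; apply: ereal_sup_ubound; exists k.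
have G0 w : (0 <= G w)%E by exact: le_trans (einfs0 w 0%N) (einfsG w 0%N).
have GC : (\int[P]_w G w <= biconjugate (Eint P h) z - \int[P]_w (c w)%:E)%E.
  have := fatou P measurableT mE (fun k w _ => E0 k w).
  move=> /le_trans; apply; rewrite limn_einf_lim.
  apply: lime_le; first exact: is_cvg_einfs.
  apply: nearW => k; apply: le_trans (EC k); apply: ereal_inf_lbound.
  by exists k => /=.
have mG : measurable_fun setT G.
  rewrite /G /limn_einf; apply: measurableT_comp => //.
  apply: (measurable_fun_limn_esup (fun k => _)) => k.
  exact: measurableT_comp.
have iG : P.-integrable setT G.
  apply/integrableP; split => //.
  under eq_integral do rewrite gee0_abs//.
  apply: le_lt_trans GC _; rewrite -(fineK bicfin) -(fineK cfin) -EFinB.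
  exact: ltry.
have hzM w (M : R) : hfin x0 w -> (G w < M%:E)%E -> (h (z w) w <= (M + c w)%:E)%E.
  move=> xw GM; have M0 : 0 < M by rewrite -lte_fin; exact: le_lt_trans GM.
  apply: (@epi_closed_le _ _ (h ^~ w)); first exact: (proj1 (proj1 nh)).
  (* At distance below [delta] from [z w], both [eta] and [dotv (v0 w) eta] are within [eps] of
     their values at [z w]. *)
  move=> eps eps0; pose delta := eps / (1 + enorm (v0 w)).
  have v01 : 0 < 1 + enorm (v0 w) by rewrite ltr_pwDl ?enorm_ge0.
  have delta0 : 0 < delta by rewrite divr_gt0.
  have [N Nlt] : exists N, N.+1%:R^-1 < delta ^+ 2 / M.
    have /ltr_add_invr[N] : 0 < delta ^+ 2 / M by rewrite divr_gt0// exprn_gt0.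
    by rewrite add0r; exists N.
  (* Some [k >= N] has [e k w < M], so the squared distance of [eta] to [z w] is at most
     [e k w / (k+1)], below [M / (N+1) < delta ^+ 2]. *)
  have [_ [k /= Nk <-]] := ereal_inf_lt (le_lt_trans (einfsG w N) GM).
  rewrite /E lte_fin gt_max => /andP[ekM _].
  have [_ /(_ w xw)[ek0 [eta [etaz heta]]] _] := eP k.
  have etad : enorm (eta - z w) < delta.
    rewrite -ltr_sqr ?nnegrE ?enorm_ge0 ?(ltW delta0)// enorm_sqr.
    apply: (le_lt_trans etaz); rewrite ltr_pdivlMr// in Nlt.
    apply: le_lt_trans Nlt; rewrite ler_pM ?invr_ge0// ?(ltW ekM)//.
    by rewrite lef_pV2 ?posrE// ler_nat ltnS.
  exists (eta, M + dotv (v0 w) eta - b0 w); split => /=.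
  - rewrite /epi/= (le_trans heta)// lee_fin; lra.
  - apply: (lt_le_trans etad); rewrite /delta ler_pdivrMr// ler_peMr ?(ltW eps0)//.
    by rewrite lerDl enorm_ge0.
  - rewrite (_ : _ - _ = dotv (v0 w) (eta - z w)); last first.
      by rewrite dotvBr /c (dotvC (z w)); ring.
    apply: (le_lt_trans (dotv_norm_le _ _)).
    apply: (@le_lt_trans _ _ (enorm (v0 w) * delta)).
      by rewrite ler_wpM2l ?enorm_ge0// ltW.
    rewrite /delta mulrA ltr_pdivrMr// mulrC ltr_pM2l//.
    by rewrite ltrDr.
have hzG w : hfin x0 w -> (h (z w) w <= G w + (c w)%:E)%E.
  move=> xw; have := G0 w; have := hzM w ^~ xw.
  case: (G w) => [g| |]// hM _; last by rewrite addye ?leey.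
  apply/lee_addgt0Pr => s s0; rewrite -!EFinD.
  by rewrite addrAC; apply: hM; rewrite lte_fin ltrDl.
have := Eint_le (proj1 nh) Eint_neqNy (integrableD measurableT iG ic) (x := z).
move=> /(_ (filterS hzG x0fin)) /le_trans; apply.
rewrite integralD// -leeBrDr//.
Qed.

End moreau_envelope.

Theorem theorem6 (R : realType) (d : measure_display) (T : measurableType d)
    (P : probability T R) (n : nat) (h : 'rV[R]_n -> T -> \bar R) :
  convex_normal_integrand h ->
  proper_fun (Eint P h) ->
  Dset P h !=set0 ->
  Dset P h `<=` edom (Eint P h) ->
  [/\ closed_fun (Eint P h), proper_fun (Eint P h) & convex_fun (Eint P h)] /\
  closed (affine_hull (edom (Eint P h))) /\
  rint (edom (Eint P h)) = Dset P h /\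
  (forall x : Linf P n, Dset P h x ->
    Eint P h y @[y --> within (affine_hull (edom (Eint P h))) (nbhs x)]
      --> Eint P h x).
Proof.
move=> nh pr D0 Dsub; have [NNy _] := pr; have [x0 Dx0] := D0.
split; [split => //|split; [|split]].
- have [v0 [mv0 iv0 v0P]] := integrable_subgradient nh NNy Dsub Dx0.
  apply/funext => z; apply/le_anti/andP; split; first exact: biconjugate_le.
  by apply: (@Eint_le_biconjugate _ _ _ _ _ _ nh NNy x0 v0) => //; exact: Dsub.
- by apply: Eint_convex => //; [exact: (proj1 nh)|exact: (proj2 nh)].
- rewrite affine_hull_edom_Eint//; apply: Linf_sel_closed => w.
  exact: affine_hull_affine.
- exact: rint_edom_Eint.
- by move=> x; exact: Eint_continuous.
Qed.
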